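(* The following two identities hold: \[ \sum_{n=0}^{\infty} \frac{\left(\frac18\right)_n \left(\frac38\right)_n\left(\frac58 \right)_n\left(\frac78\right)_n}{\left(\frac12\right)_n(1)_n^3} \left( \frac{-2^{14}}{23^4} \right)^n \frac{6970n^2+4037n+280}{529(2n+1)}=\frac{\sqrt{23}}{3\pi}, \] and \[ \sum_{n=0}^{\infty} \frac{\left(\frac18\right)_n \left(\frac38\right)_n\left(\frac58 \right)_n\left(\frac78\right)_n}{\left(\frac12\right)_n(1)_n^3} \left( \frac{-2^{14}}{23^4} \right)^n \frac{-296225n^3-24576n^2+53002n+4200}{3174}=\frac{\sqrt{23}}{\pi}. \]
   Context: For a complex number $a$ and integer $n\ge 0$, $(a)_n=a(a+1)\cdots(a+n-1)$ denotes the Pochhammer symbol (rising factorial), with $(a)_0=1$. *)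

(* Defs.v *)
From Stdlib Require Import Reals.
From Coquelicot Require Import Coquelicot.
Open Scope R_scope.

(** Pochhammer symbol, for real [a] only: all parameters in use are rational. *)
Fixpoint poch (a : R) (n : nat) : R :=
  match n with
  | O => 1
  | S m => poch a m * (a + INR m)
  end.

(* Main.v *)
Require Import Defs.
From Stdlib Require Import Reals Lra Lia Psatz.
From Coquelicot Require Import Coquelicot.
Open Scope R_scope.

(** Write [f] for 2F1(1/4,3/4;1;.), [K] for 2F1(1/2,1/2;1;.), and [G(z)] for the
    4F3 series without the polynomial factor.

    Brafman's formula at [x = 0] reads [G(-y^2) = f(a) f(b)] with
    [a = (1 - C - y)/2], [b = (1 - C + y)/2], [C = sqrt (1 + y^2)].  Here
    [y = 128/529], and [a], [b] lie in Q(sqrt 41).  For [p = (sqrt 41 - 5)/2], the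
    values [f(a)] and [f(b)] are algebraic multiples of [K(1 - p^2)] and of the
    complementary [K(p^2)], so that complex multiplication is not needed.  The
    combination of [f(a) f(b)], [f'(a) f(b)], [f(a) f'(b)] in the first series is
    then a multiple of the Legendre combination
    [K'(v) K(1-v) + K(v) K'(1-v) = 1 / (PI v (1-v))] at [v = 1 - p^2].  The second
    series is three times the first one plus a telescoping series. *)

(** * The functions 2F1(s,1-s;1;x) *)

(** The product formula and both transformations are identities between two solutions of one
    differential equation that are regular at a singular point. Uniqueness from initial values fails
    there, so regularity has to do the work: through a contraction for the product formula, through
    a Wronskian for the transformations. The hypergeometric equation is used in the form
    [(x (1 - x) f')' = m f], which gives a first order system for [f] and its flux [x (1 - x) f'].

    Complex multiplication is avoided for the following reason. Brafman's formula traces a curve of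
    pairs [(a, b)] as [y] varies. The two transformations trace another one as [p] varies, made of
    the pairs tied to [K(1 - p^2)] and [K(p^2)] with the same [p]. All along the second curve the
    Legendre relation is available, and [y = 128/529] gives a common point of the two curves. *)

Definition inside (a : nat -> R) (x : R) : Prop :=
  Rbar_lt (Rabs x) (CV_radius a).

Lemma inside_bounded (a : nat -> R) (x : R) :
  (forall n, Rabs (a n) <= 1) -> Rabs x < 1 -> inside a x.
Proof.
  intros Ha Hx.
  apply Rbar_lt_le_trans with (Finite 1); [exact Hx|].
  apply (CV_radius_bounded a). exists 1. intro n.
  now rewrite pow1, Rmult_1_r.
Qed.

Lemma inside_derive (a : nat -> R) (x : R) : inside a x -> inside (PS_derive a) x.
Proof. unfold inside. now rewrite CV_radius_derive. Qed.

Lemma inside_incr (a : nat -> R) (x : R) : inside a x -> inside (PS_incr_1 a) x.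
Proof. unfold inside. now rewrite CV_radius_incr_1. Qed.

Lemma is_derive_PSeries_comp (a : nat -> R) (g : R -> R) (x dg : R) :
  inside a (g x) -> is_derive g x dg ->
  is_derive (fun t => PSeries a (g t)) x (dg * PSeries (PS_derive a) (g x)).
Proof.
  intros Ha Hg.
  exact (is_derive_comp (PSeries a) g x _ _ (is_derive_PSeries a (g x) Ha) Hg).
Qed.

Lemma is_series_PSeries (a : nat -> R) (x : R) :
  inside a x -> is_series (fun n => a n * x ^ n) (PSeries a x).
Proof.
  intro Ha. apply is_pseries_R, PSeries_correct, CV_radius_inside, Ha.
Qed.

(** [hgc m] are the coefficients of 2F1(s,1-s;1;x) with [m = s(1-s)], as
    [(n+s)(n+1-s) = n^2 + n + m]. *)
Fixpoint hgc (m : R) (n : nat) : R :=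
  match n with
  | O => 1
  | S k => hgc m k * ((INR k ^ 2 + INR k + m) / (INR k + 1) ^ 2)
  end.

Definition hg (m x : R) : R := PSeries (hgc m) x.
Definition hg' (m x : R) : R := PSeries (PS_derive (hgc m)) x.

Section Hypergeometric.
Variable m : R.
Hypothesis Hm : 0 < m <= 1/4.

Lemma hgc_bounds n : 0 < hgc m n <= 1.
Proof.
  induction n as [|n IH]; cbn [hgc]; [lra|].
  pose proof (pos_INR n).
  assert (0 < (INR n ^ 2 + INR n + m) / (INR n + 1) ^ 2 <= 1).
  { split.
    - apply Rdiv_lt_0_compat; nra.
    - apply Rle_div_l; nra. }
  split; [apply Rmult_lt_0_compat; lra|].
  apply Rle_trans with (1 * 1); [apply Rmult_le_compat; lra|lra].
Qed.

Lemma hgc_inside x : Rabs x < 1 -> inside (hgc m) x.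
Proof.
  apply inside_bounded. intro n. destruct (hgc_bounds n).
  rewrite Rabs_pos_eq; lra.
Qed.

Lemma hg_0 : hg m 0 = 1.
Proof. unfold hg. rewrite PSeries_0. reflexivity. Qed.

Lemma hg_pos x : 0 <= x < 1 -> 0 < hg m x.
Proof.
  intros [Hx0 Hx1].
  assert (Hx : Rabs x < 1) by (rewrite Rabs_pos_eq; lra).
  assert (Hs := is_series_PSeries (hgc m) x (hgc_inside x Hx)).
  unfold hg. rewrite <- (is_series_unique _ _ Hs).
  apply Rlt_le_trans with 1; [lra|].
  rewrite Series_incr_1 by (eexists; exact Hs).
  cbn [hgc pow].
  enough (0 <= Series (fun k => hgc m (S k) * x ^ S k)) by (cbn [hgc pow] in *; lra).
  rewrite <- (PSeries_const_0 x).
  apply Series_le.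
  - intro n. split; [lra|]. rewrite Rmult_0_l. apply Rmult_le_pos; [apply Rlt_le, hgc_bounds|now apply pow_le].
  - apply (ex_series_incr_1 (fun k => hgc m k * x ^ k)). eexists; exact Hs.
Qed.

Lemma is_derive_hg_comp (g : R -> R) x dg :
  Rabs (g x) < 1 -> is_derive g x dg ->
  is_derive (fun t => hg m (g t)) x (dg * hg' m (g x)).
Proof. intros Hx. apply is_derive_PSeries_comp, hgc_inside, Hx. Qed.

(** This is the hypergeometric equation [(x (1 - x) f')' = m f] integrated once: coefficient by
    coefficient it is the recurrence of [hgc]. *)
Lemma hg_flux_eq x : Rabs x < 1 ->
  x * (1 - x) * hg' m x
  = PSeries (PS_incr_1 (fun n => m * hgc m n / INR (S n))) x.
Proof.
  intro Hx. unfold hg'.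
  assert (Hi := hgc_inside x Hx).
  assert (Hd := inside_derive _ _ Hi).
  replace (x * (1 - x) * PSeries (PS_derive (hgc m)) x)
    with (x * PSeries (PS_derive (hgc m)) x
          - x * (x * PSeries (PS_derive (hgc m)) x)) by ring.
  rewrite <- !PSeries_incr_1.
  rewrite <- PSeries_minus.
  2,3: apply CV_radius_inside; repeat apply inside_incr; exact Hd.
  apply PSeries_ext. intros [|[|n]]; unfold PS_minus, PS_plus, PS_opp, PS_incr_1, PS_derive, plus, opp, zero; cbn -[INR hgc].
  - ring.
  - cbn. field.
  - pose proof (pos_INR n). cbn [hgc]. rewrite !S_INR. field. lra.
Qed.

Lemma is_derive_flux_comp (g : R -> R) x dg :
  Rabs (g x) < 1 -> is_derive g x dg ->
  is_derive (fun t => g t * (1 - g t) * hg' m (g t)) x (dg * (m * hg m (g x))).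
Proof.
  intros Hx Hg.
  assert (Hb : inside (fun n => m * hgc m n / INR (S n)) (g x)).
  { apply inside_bounded; [|exact Hx]. intro n.
    destruct (hgc_bounds n). pose proof (pos_INR n). rewrite S_INR.
    rewrite Rabs_pos_eq.
    - apply Rle_div_l; nra.
    - apply Rlt_le, Rdiv_lt_0_compat; nra. }
  apply (is_derive_ext_loc
    (fun t => PSeries (PS_incr_1 (fun n => m * hgc m n / INR (S n))) (g t))).
  (* [hg_flux_eq] holds only in the unit disc, so continuity of [g] is used to have it on a whole
     neighbourhood of [x]. *)
  - assert (Hc : continuous (g : R -> R) x) by (apply (ex_derive_continuous (V := R_NormedModule)); eexists; exact Hg).
    assert (Hl : @locally R_UniformSpace (g x) (fun z => Rabs z < 1)).
    { apply (open_comp (fun z => Rabs z) (fun z => z < 1)).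
      - intros z _. apply continuous_Rabs.
      - apply open_lt.
      - exact Hx. }
    generalize (Hc _ Hl). unfold filtermap. apply filter_imp. intros t Ht. symmetry. now apply hg_flux_eq.
  - replace (m * hg m (g x)) with
      (PSeries (PS_derive (PS_incr_1 (fun n => m * hgc m n / INR (S n)))) (g x)).
    + apply is_derive_PSeries_comp; [now apply inside_incr|exact Hg].
    + unfold hg. rewrite <- PSeries_scal.
      apply PSeries_ext. intro n. unfold PS_derive, PS_incr_1, PS_scal, scal; cbn -[INR hgc].
      unfold mult; cbn -[INR hgc]. pose proof (pos_INR n). rewrite S_INR. field. lra.
Qed.

End Hypergeometric.

(** * A singular differential system *)

(** Integrating a bound gains one power of [t]: the mean value theorem is applied to
    [c s^(k+1) / (k+1)] plus and minus [h], the sign being [sg]. *)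
Lemma Rabs_le_of_derive_le (h h' : R -> R) (c t : R) (k : nat) :
  0 < t -> h 0 = 0 ->
  (forall s, 0 <= s <= t -> is_derive h s (h' s)) ->
  (forall s, 0 < s < t -> Rabs (h' s) <= c * s ^ k) ->
  Rabs (h t) <= c * t ^ S k / INR (S k).
Proof.
  intros Ht H0 Hd Hb.
  assert (Hk : INR (S k) <> 0) by (apply not_0_INR; lia).
  assert (Hpow : forall sg s, 0 <= s <= t ->
    derivable_pt_lim (fun s => c * s ^ S k / INR (S k) + sg * h s) s (c * s ^ k + sg * h' s)).
  { intros sg s Hs. apply is_derive_Reals. specialize (Hd s Hs).
    auto_derive.
    - repeat split; try lra. eexists; exact Hd.
    - replace (Derive (fun x : R => h x) s) with (h' s)
        by (symmetry; apply is_derive_unique, Hd).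
      change (match k with O => 1 | S _ => INR k + 1 end) with (INR (S k)).
      field. exact Hk. }
  assert (Hsg : forall sg, Rabs sg = 1 -> 0 <= c * t ^ S k / INR (S k) + sg * h t).
  { intros sg Hsg.
    destruct (MVT_cor2 _ _ 0 t Ht (Hpow sg)) as [s [Heq Hs]].
    rewrite H0, pow_i in Heq by lia.
    specialize (Hb s Hs).
    assert (Hc : Rabs (sg * h' s) <= c * s ^ k) by (rewrite Rabs_mult, Hsg; lra).
    apply Rabs_le_between in Hc.
    assert (0 <= (c * s ^ k + sg * h' s) * (t - 0)) by (apply Rmult_le_pos; lra).
    lra. }
  pose proof (Hsg 1 Rabs_R1) as H1.
  pose proof (Hsg (-1) ltac:(rewrite Rabs_left; lra)) as H2.
  apply Rabs_le. lra.
Qed.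

Lemma eq_0_of_le_half_pow (x M : R) : (forall n, Rabs x <= M * (1/2) ^ n) -> x = 0.
Proof.
  intro H.
  assert (Hl : is_lim_seq (fun n => M * (1/2) ^ n) 0).
  { replace (Finite 0) with (Rbar_mult M 0) by (cbn; f_equal; ring).
    apply is_lim_seq_scal_l, is_lim_seq_geom. rewrite Rabs_pos_eq; lra. }
  assert (Hle := is_lim_seq_le _ _ (Rabs x) 0 H (is_lim_seq_const _) Hl).
  cbn in Hle. destruct (Req_dec x 0) as [|Hx]; [assumption|].
  pose proof (Rabs_pos_lt x Hx). lra.
Qed.

Definition cosh_arsinh (y : R) : R := sqrt (1 + y ^ 2).

Lemma cosh_sqr y : cosh_arsinh y * cosh_arsinh y = 1 + y * y.
Proof. unfold cosh_arsinh. rewrite sqrt_sqrt; nra. Qed.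

Lemma cosh_ge_1 y : 1 <= cosh_arsinh y.
Proof. unfold cosh_arsinh. rewrite <- sqrt_1 at 1. apply sqrt_le_1; nra. Qed.

(** Satisfied by [x1 = u v], [z = x1'], [x2 = a v + b u], [y^2 e = a b] and
    [x4 = a v - b u], where [u], [v] solve the hypergeometric equation at the
    arguments [(1 - C - y)/2], [(1 - C + y)/2] with [C = cosh (arsinh y)], and
    [a], [b] are the corresponding values of [x (1 - x) f']. *)
Section System.
Variables (m Y M : R) (x1 z x2 e x4 : R -> R).
Hypothesis Hm : 0 < m <= 1/4.
Hypothesis HY : 0 < Y < 1.
Hypothesis Hx1 : forall y, 0 <= y <= Y -> is_derive x1 y (z y).
Hypothesis Hx2 : forall y, 0 <= y <= Y ->
  is_derive x2 y (y * (2 * e y - m * x1 y) / cosh_arsinh y).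
Hypothesis Hx3 : forall y, 0 <= y <= Y ->
  is_derive (fun y => y ^ 2 * e y) y (m / 2 * (x4 y - y ^ 2 * z y)).
Hypothesis Hx4 : forall y, 0 <= y <= Y -> is_derive x4 y (- m * x1 y).
Hypothesis Hz : forall y, 0 <= y <= Y -> x2 y = cosh_arsinh y * y * z y.
Hypothesis H1 : x1 0 = 0.
Hypothesis H4 : x4 0 = 0.

(** The bound on [z] goes once around the system: [B y] for [x1], [m B y^2 / 2] for [x4],
    [B y^3 / 12] for [y^2 e], hence [B y / 12] for [e], then [B y^3 / 6] for [x2]. Dividing [x2] by
    [C y], with [C >= 1] and [y < 1], returns at most [B / 6] for [z]; the factor 1/2 is
    generous. *)
Lemma system_contracts B :
  0 <= B -> (forall y, 0 < y <= Y -> Rabs (z y) <= B) ->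
  forall y, 0 < y <= Y -> Rabs (z y) <= B * (1/2).
Proof.
  intros HB Hb.
  assert (B1 : forall y, 0 < y <= Y -> Rabs (x1 y) <= B * y).
  { intros y Hy.
    replace (B * y) with (B * y ^ 1 / INR 1) by (cbn; field).
    apply (Rabs_le_of_derive_le x1 z); try lra.
    - intros s Hs. apply Hx1. lra.
    - intros s Hs. cbn. rewrite Rmult_1_r. apply Hb. lra. }
  assert (B4 : forall y, 0 < y <= Y -> Rabs (x4 y) <= m * B / 2 * y ^ 2).
  { intros y Hy.
    replace (m * B / 2 * y ^ 2) with (m * B * y ^ 2 / INR 2) by (cbn; field).
    apply (Rabs_le_of_derive_le x4 (fun y => - m * x1 y)); try lra.
    - intros s Hs. apply Hx4. lra.
    - intros s Hs. cbv beta. rewrite Rabs_mult, Rabs_Ropp, (Rabs_pos_eq m), pow_1 by lra.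
      rewrite Rmult_assoc. apply Rmult_le_compat_l; [lra|]. apply B1. lra. }
  assert (B3 : forall y, 0 < y <= Y -> Rabs (y ^ 2 * e y) <= B / 12 * y ^ 3).
  { intros y Hy.
    replace (B / 12 * y ^ 3) with (B / 4 * y ^ 3 / INR 3) by (cbn; field).
    apply (Rabs_le_of_derive_le (fun y => y ^ 2 * e y)
             (fun y => m / 2 * (x4 y - y ^ 2 * z y))); try (cbv beta; lra).
    - intros s Hs. apply Hx3. lra.
    - intros s Hs. cbv beta.
      assert (Hs' : 0 < s <= Y) by lra.
      pose proof (B4 s Hs') as G4. pose proof (Hb s Hs') as Gz.
      assert (Rabs (s ^ 2 * z s) <= B * s ^ 2).
      { rewrite Rabs_mult, (Rabs_pos_eq (s ^ 2)) by nra.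
        rewrite Rmult_comm. apply Rmult_le_compat_r; [nra|lra]. }
      rewrite Rabs_mult, (Rabs_pos_eq (m / 2)) by lra.
      assert (Rabs (x4 s - s ^ 2 * z s) <= m * B / 2 * s ^ 2 + B * s ^ 2).
      { unfold Rminus. eapply Rle_trans; [apply Rabs_triang|]. rewrite Rabs_Ropp. lra. }
      assert (0 <= B * s ^ 2) by (apply Rmult_le_pos; [lra|nra]).
      apply Rle_trans with (m / 2 * (m * B / 2 * s ^ 2 + B * s ^ 2)).
      + apply Rmult_le_compat_l; lra.
      + replace (m / 2 * (m * B / 2 * s ^ 2 + B * s ^ 2))
          with (m / 2 * (m / 2 + 1) * (B * s ^ 2)) by field.
        replace (B / 4 * s ^ 2) with (1 / 4 * (B * s ^ 2)) by field.
        apply Rmult_le_compat_r; nra. }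
  assert (Be : forall y, 0 < y <= Y -> Rabs (e y) <= B / 12 * y).
  { intros y Hy. specialize (B3 y Hy).
    rewrite Rabs_mult, (Rabs_pos_eq (y ^ 2)) in B3 by nra.
    apply Rmult_le_reg_l with (y ^ 2); [nra|].
    replace (y ^ 2 * (B / 12 * y)) with (B / 12 * y ^ 3) by ring. exact B3. }
  assert (B2 : forall y, 0 < y <= Y -> Rabs (x2 y) <= B / 6 * y ^ 3).
  { intros y Hy.
    replace (B / 6 * y ^ 3) with (B / 2 * y ^ 3 / INR 3) by (cbn; field).
    apply (Rabs_le_of_derive_le x2 (fun y => y * (2 * e y - m * x1 y) / cosh_arsinh y)); try lra.
    - rewrite Hz by lra. ring.
    - intros s Hs. apply Hx2. lra.
    - intros s Hs. cbv beta.
      assert (Hs' : 0 < s <= Y) by lra.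
      pose proof (Be s Hs') as Ge. pose proof (B1 s Hs') as G1.
      pose proof (cosh_ge_1 s) as HC.
      assert (Rabs (2 * e s - m * x1 s) <= B / 2 * s).
      { unfold Rminus. eapply Rle_trans; [apply Rabs_triang|].
        rewrite Rabs_Ropp, !Rabs_mult, (Rabs_pos_eq 2), (Rabs_pos_eq m) by lra.
        assert (m * Rabs (x1 s) <= 1 / 4 * (B * s)).
        { apply Rmult_le_compat; try lra. apply Rabs_pos. }
        assert (0 <= B * s) by (apply Rmult_le_pos; lra).
        lra. }
      unfold Rdiv. rewrite !Rabs_mult, (Rabs_pos_eq s), Rabs_inv, (Rabs_pos_eq (cosh_arsinh s)) by lra.
      apply Rle_div_l; [lra|].
      assert (0 <= B / 2 * s ^ 2) by (apply Rmult_le_pos; nra).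
      apply Rle_trans with (s * (B / 2 * s)).
      + apply Rmult_le_compat_l; lra.
      + nra. }
  intros y Hy. specialize (B2 y Hy). rewrite Hz in B2 by lra.
  pose proof (cosh_ge_1 y) as HC.
  rewrite !Rabs_mult, (Rabs_pos_eq (cosh_arsinh y)), (Rabs_pos_eq y) in B2 by lra.
  apply Rmult_le_reg_l with y; [lra|].
  pose proof (Rabs_pos (z y)).
  assert (0 <= y * Rabs (z y)) by (apply Rmult_le_pos; lra).
  assert (B / 6 * y ^ 3 <= B / 6 * y).
  { apply Rmult_le_compat_l; [lra|].
    assert (y * (y * y) <= y * 1) by (apply Rmult_le_compat_l; nra).
    cbn [pow]. lra. }
  assert (0 <= B * y) by (apply Rmult_le_pos; lra).
  nra.
Qed.

(** The origin is a singular point of the system, so the zero solution is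
    singled out by boundedness of [z] and not only by the initial values. *)
Lemma system_unique :
  (forall y, 0 < y <= Y -> Rabs (z y) <= M) ->
  z Y = 0 /\ x1 Y = 0 /\ x4 Y = 0.
Proof.
  intros HM.
  assert (HM0 : 0 <= M).
  { eapply Rle_trans; [apply Rabs_pos|apply (HM Y); lra]. }
  assert (Hn : forall n y, 0 < y <= Y -> Rabs (z y) <= M * (1/2) ^ n).
  { intro n. induction n as [|n IH]; intros y Hy.
    - cbn. rewrite Rmult_1_r. now apply HM.
    - replace (M * (1/2) ^ S n) with (M * (1/2) ^ n * (1/2)) by (cbn; ring).
      apply system_contracts; [|exact IH|exact Hy].
      apply Rmult_le_pos; [exact HM0|apply pow_le; lra]. }
  assert (Hz0 : forall y, 0 < y <= Y -> z y = 0).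
  { intros y Hy. apply (eq_0_of_le_half_pow _ M). intro n. now apply Hn. }
  assert (Hx0 : forall y, 0 < y <= Y -> x1 y = 0).
  { intros y Hy.
    assert (Hb : Rabs (x1 y) <= 0 * y ^ 1 / INR 1).
    { apply (Rabs_le_of_derive_le x1 z); try lra.
      - intros s Hs. apply Hx1. lra.
      - intros s Hs. rewrite Hz0, Rabs_R0 by lra. lra. }
    rewrite Rmult_0_l in Hb. unfold Rdiv in Hb. rewrite Rmult_0_l in Hb.
    apply Rabs_eq_0. pose proof (Rabs_pos (x1 y)). lra. }
  repeat split; [apply Hz0; lra|apply Hx0; lra|].
  assert (Hb : Rabs (x4 Y) <= 0 * Y ^ 1 / INR 1).
  { apply (Rabs_le_of_derive_le x4 (fun y => - m * x1 y)); try lra.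
    - intros s Hs. apply Hx4. lra.
    - intros s Hs. rewrite Hx0, Rmult_0_r, Rabs_R0 by lra. lra. }
  rewrite Rmult_0_l in Hb. unfold Rdiv in Hb. rewrite Rmult_0_l in Hb.
  apply Rabs_eq_0. pose proof (Rabs_pos (x4 Y)). lra.
Qed.
End System.

(** * The product formula *)

Definition sums (a : nat -> R) (x l : R) : Prop := is_series (fun n => a n * x ^ n) l.

Lemma sums_plus a b x la lb :
  sums a x la -> sums b x lb -> sums (fun n => a n + b n) x (la + lb).
Proof.
  intros Ha Hb. eapply is_series_ext; [|exact (is_series_plus _ _ _ _ Ha Hb)].
  intro n. unfold plus; cbn. ring.
Qed.

Lemma sums_scal c a x l : sums a x l -> sums (fun n => c * a n) x (c * l).
Proof.
  intros Ha. eapply is_series_ext; [|exact (is_series_scal_l c _ _ Ha)].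
  intro n. cbn. ring.
Qed.

Lemma sums_shift a x l : sums a x l -> sums (PS_incr_1 a) x (x * l).
Proof.
  intros Ha. apply is_pseries_R. apply (is_pseries_incr_1 a x l).
  now apply is_pseries_R.
Qed.

(** The differential equations below are reduced to this: the difference of both sides is assembled
    as one series out of shifts and multiples, and each of its coefficients is zero. *)
Lemma sums_zero a x l : sums a x l -> (forall n, a n = 0) -> l = 0.
Proof.
  intros Ha H. apply is_series_unique in Ha. rewrite <- Ha.
  rewrite <- (PSeries_const_0 x). apply Series_ext. intro n. now rewrite H.
Qed.

Definition coef (n : nat) : R :=
  (poch (1/8) n * poch (3/8) n * poch (5/8) n * poch (7/8) n)
  / (poch (1/2) n * (poch 1 n) ^ 3).

Lemma poch_pos a n : 0 < a -> 0 < poch a n.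
Proof.
  intro Ha. induction n as [|n IH]; cbn [poch]; [lra|].
  pose proof (pos_INR n). apply Rmult_lt_0_compat; lra.
Qed.

Lemma coef_0 : coef 0 = 1.
Proof. unfold coef. cbn. field. Qed.

Lemma coef_S n : coef (S n) = coef n *
  ((1/8 + INR n) * (3/8 + INR n) * (5/8 + INR n) * (7/8 + INR n)
   / ((1/2 + INR n) * (1 + INR n) ^ 3)).
Proof.
  unfold coef. cbn [poch].
  assert (H2 := poch_pos (1/2) n ltac:(lra)). assert (H1 := poch_pos 1 n ltac:(lra)).
  pose proof (pos_INR n). field. repeat split; lra.
Qed.

Lemma coef_bounds n : 0 < coef n <= 1.
Proof.
  induction n as [|n IH]; [rewrite coef_0; lra|].
  rewrite coef_S. pose proof (pos_INR n) as Hn.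
  assert (0 < (1/8 + INR n) * (3/8 + INR n) * (5/8 + INR n) * (7/8 + INR n)
   / ((1/2 + INR n) * (1 + INR n) ^ 3) <= 1).
  { split.
    - repeat (apply Rdiv_lt_0_compat || apply Rmult_lt_0_compat || apply pow_lt); lra.
    - apply Rle_div_l; [repeat (apply Rmult_lt_0_compat || apply pow_lt); lra|].
      rewrite Rmult_1_l.
      replace ((1/2 + INR n) * (1 + INR n) ^ 3)
        with (((1/2 + INR n) * (1 + INR n)) * ((1 + INR n) * (1 + INR n))) by ring.
      replace ((1 / 8 + INR n) * (3 / 8 + INR n) * (5 / 8 + INR n) * (7 / 8 + INR n))
        with (((1 / 8 + INR n) * (3 / 8 + INR n)) * ((5 / 8 + INR n) * (7 / 8 + INR n))) by ring.
      apply Rmult_le_compat; nra. }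
  split; [apply Rmult_lt_0_compat; lra|].
  apply Rle_trans with (1 * 1); [apply Rmult_le_compat; lra|lra].
Qed.

Definition m316 : R := 3/16.
(** With [u], [v] the two factors of the product and [a], [b] the values of
    [x (1 - x) f'] at their arguments, these two sequences generate [a v - b u]
    and [a b]: their series are [- (a v - b u) / (m316 y)] and [- a b / y^2] at
    [- y^2]. *)
Definition coef_H (n : nat) : R := coef n / (2 * INR n + 1).
Definition coef_E (n : nat) : R :=
  m316 / 4 * (m316 / (2 * INR n + 1) + 2 * INR n) * coef n / (INR n + 1).

Lemma coef_inside x : Rabs x < 1 -> inside coef x.
Proof.
  apply inside_bounded. intro n. destruct (coef_bounds n). rewrite Rabs_pos_eq; lra.
Qed.

Lemma coef_H_inside x : Rabs x < 1 -> inside coef_H x.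
Proof.
  apply inside_bounded. intro n. destruct (coef_bounds n).
  pose proof (pos_INR n). unfold coef_H. rewrite Rabs_pos_eq.
  - apply Rle_div_l; lra.
  - apply Rlt_le, Rdiv_lt_0_compat; lra.
Qed.

Lemma coef_E_inside x : Rabs x < 1 -> inside coef_E x.
Proof.
  apply inside_bounded. intro n. destruct (coef_bounds n).
  pose proof (pos_INR n). unfold coef_E, m316.
  assert (0 <= 3 / 16 / (2 * INR n + 1) <= 1).
  { split; [apply Rlt_le, Rdiv_lt_0_compat; lra|apply Rle_div_l; lra]. }
  rewrite Rabs_pos_eq.
  - apply Rle_div_l; [lra|].
    apply Rle_trans with ((1 + INR n) * 1); [apply Rmult_le_compat|]; lra.
  - apply Rdiv_le_0_compat; [|lra]. apply Rmult_le_pos; lra.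
Qed.

(** * Differential equations linking the three series *)

Section Series_ODE.
Variable x : R.
Hypothesis Hx : Rabs x < 1.

Let S0 : sums coef x (PSeries coef x) := is_series_PSeries _ _ (coef_inside x Hx).
Let S1 : sums (PS_derive coef) x (PSeries (PS_derive coef) x) :=
  is_series_PSeries _ _ (inside_derive _ _ (coef_inside x Hx)).
Let S2 : sums (PS_derive (PS_derive coef)) x (PSeries (PS_derive (PS_derive coef)) x) :=
  is_series_PSeries _ _ (inside_derive _ _ (inside_derive _ _ (coef_inside x Hx))).
Let SH : sums coef_H x (PSeries coef_H x) := is_series_PSeries _ _ (coef_H_inside x Hx).
Let SE : sums coef_E x (PSeries coef_E x) := is_series_PSeries _ _ (coef_E_inside x Hx).
Let SH1 : sums (PS_derive coef_H) x (PSeries (PS_derive coef_H) x) :=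
  is_series_PSeries _ _ (inside_derive _ _ (coef_H_inside x Hx)).
Let SE1 : sums (PS_derive coef_E) x (PSeries (PS_derive coef_E) x) :=
  is_series_PSeries _ _ (inside_derive _ _ (coef_E_inside x Hx)).

Lemma ode_H : PSeries coef_H x + 2 * (x * PSeries (PS_derive coef_H) x) = PSeries coef x.
Proof.
  apply Rminus_diag_uniq.
  replace (_ - _) with (PSeries coef_H x + 2 * (x * PSeries (PS_derive coef_H) x)
    + (-1) * PSeries coef x) by ring.
  refine (sums_zero _ x _ (sums_plus _ _ _ _ _ (sums_plus _ _ _ _ _ SH
    (sums_scal 2 _ _ _ (sums_shift _ _ _ SH1))) (sums_scal (-1) _ _ _ S0)) _).
  intros [|n]; unfold coef_H, PS_incr_1, PS_derive, zero; cbn -[INR coef].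
  - cbn [INR]. field.
  - pose proof (pos_INR n). rewrite S_INR. field. lra.
Qed.

Lemma ode_E :
  4 * (PSeries coef_E x + x * PSeries (PS_derive coef_E) x)
  = m316 * (m316 * PSeries coef_H x + 2 * (x * PSeries (PS_derive coef) x)).
Proof.
  apply Rminus_diag_uniq.
  match goal with |- ?a - ?b = 0 => replace (a - b) with
    (4 * PSeries coef_E x + 4 * (x * PSeries (PS_derive coef_E) x)
    + (- m316 ^ 2) * PSeries coef_H x + (- 2 * m316) * (x * PSeries (PS_derive coef) x)) by ring end.
  refine (sums_zero _ x _ (sums_plus _ _ _ _ _ (sums_plus _ _ _ _ _ (sums_plus _ _ _ _ _
    (sums_scal 4 _ _ _ SE) (sums_scal 4 _ _ _ (sums_shift _ _ _ SE1)))
    (sums_scal _ _ _ _ SH)) (sums_scal _ _ _ _ (sums_shift _ _ _ S1))) _).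
  intros [|n]; unfold coef_E, coef_H, PS_incr_1, PS_derive, zero; cbn -[INR coef].
  - cbn [INR]. field.
  - pose proof (pos_INR n). rewrite S_INR. field. lra.
Qed.

(** Here the recurrence [coef_S] of the 4F3 coefficients enters; [ode_H] and [ode_E] only unfold the
    definitions of [coef_H] and [coef_E]. The double shift in [x (x G'')] makes the coefficients 0
    and 1 separate cases. *)
Lemma ode_G :
  4 * (1 - x) * (PSeries (PS_derive coef) x + x * PSeries (PS_derive (PS_derive coef)) x)
  - 2 * (x * PSeries (PS_derive coef) x)
  = 2 * PSeries coef_E x + m316 * PSeries coef x.
Proof.
  apply Rminus_diag_uniq.
  match goal with |- ?a - ?b = 0 => replace (a - b) with
    (4 * PSeries (PS_derive coef) x + 4 * (x * PSeries (PS_derive (PS_derive coef)) x)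
     + (-6) * (x * PSeries (PS_derive coef) x)
     + (-4) * (x * (x * PSeries (PS_derive (PS_derive coef)) x))
     + (-2) * PSeries coef_E x + (- m316) * PSeries coef x) by ring end.
  refine (sums_zero _ x _ (sums_plus _ _ _ _ _ (sums_plus _ _ _ _ _ (sums_plus _ _ _ _ _
    (sums_plus _ _ _ _ _ (sums_plus _ _ _ _ _
    (sums_scal _ _ _ _ S1) (sums_scal _ _ _ _ (sums_shift _ _ _ S2)))
    (sums_scal _ _ _ _ (sums_shift _ _ _ S1)))
    (sums_scal _ _ _ _ (sums_shift _ _ _ (sums_shift _ _ _ S2))))
    (sums_scal _ _ _ _ SE)) (sums_scal _ _ _ _ S0)) _).
  intros [|[|n]]; unfold coef_E, coef_H, m316, PS_incr_1, PS_derive, zero; cbn -[INR coef].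
  - rewrite coef_S. cbn [INR]. field.
  - rewrite !coef_S. cbn [INR]. field.
  - pose proof (pos_INR n). rewrite (coef_S (S (S n))), !S_INR. field. lra.
Qed.
End Series_ODE.

Lemma is_derive_eq (f : R -> R) (x l l' : R) : is_derive f x l -> l = l' -> is_derive f x l'.
Proof. now intros H <-. Qed.

Lemma der_mult (f g : R -> R) (x df dg : R) :
  is_derive f x df -> is_derive g x dg ->
  is_derive (fun t => f t * g t) x (df * g x + f x * dg).
Proof.
  intros Hf Hg. apply (is_derive_mult f g x df dg Hf Hg). intros; apply Rmult_comm.
Qed.

Lemma der_plus (f g : R -> R) (x df dg : R) :
  is_derive f x df -> is_derive g x dg -> is_derive (fun t => f t + g t) x (df + dg).
Proof. intros Hf Hg. exact (is_derive_plus f g x df dg Hf Hg). Qed.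

Lemma der_minus (f g : R -> R) (x df dg : R) :
  is_derive f x df -> is_derive g x dg -> is_derive (fun t => f t - g t) x (df - dg).
Proof. intros Hf Hg. exact (is_derive_minus f g x df dg Hf Hg). Qed.

Lemma m316_bounds : 0 < m316 <= 1/4.
Proof. unfold m316. lra. Qed.

Definition arg_minus (y : R) : R := (1 - cosh_arsinh y - y) / 2.
Definition arg_plus (y : R) : R := (1 - cosh_arsinh y + y) / 2.

Lemma der_cosh y : is_derive cosh_arsinh y (y / cosh_arsinh y).
Proof.
  unfold cosh_arsinh. pose proof (cosh_ge_1 y) as H. unfold cosh_arsinh in H.
  eapply is_derive_eq.
  - apply (is_derive_comp sqrt (fun y => 1 + y ^ 2)).
    + apply is_derive_Reals, derivable_pt_lim_sqrt. nra.
    + auto_derive; [exact I|reflexivity].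
  - unfold scal; cbn -[pow]. unfold mult; cbn -[pow]. field. lra.
Qed.

Lemma der_arg_minus y : is_derive arg_minus y (- (cosh_arsinh y + y) / (2 * cosh_arsinh y)).
Proof.
  unfold arg_minus. pose proof (cosh_ge_1 y).
  apply (is_derive_ext (fun y => (1/2) * ((1 - y) - cosh_arsinh y))).
  - intro t. cbn. field.
  - eapply is_derive_eq.
    + apply der_mult; [apply (is_derive_const (1/2) y)|].
      apply der_minus; [|apply der_cosh].
      apply der_minus; [apply (is_derive_const 1 y)|apply (is_derive_id y)].
    + unfold zero, one; cbn. field. lra.
Qed.

Lemma der_arg_plus y : is_derive arg_plus y ((cosh_arsinh y - y) / (2 * cosh_arsinh y)).
Proof.
  unfold arg_plus. pose proof (cosh_ge_1 y).
  apply (is_derive_ext (fun y => (1/2) * ((1 + y) - cosh_arsinh y))).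
  - intro t. cbn. field.
  - eapply is_derive_eq.
    + apply der_mult; [apply (is_derive_const (1/2) y)|].
      apply der_minus; [|apply der_cosh].
      apply der_plus; [apply (is_derive_const 1 y)|apply (is_derive_id y)].
    + unfold zero, one; cbn. field. lra.
Qed.

Lemma der_neg_sqr y : is_derive (fun t => - t ^ 2) y (- 2 * y).
Proof. auto_derive; [exact I|cbn; ring]. Qed.

(** Together with [der_arg_minus], this shows that the derivative of the argument divided by
    [x (1 - x)] is [1 / (C y)]; the same value comes out for [arg_plus]. Hence
    [a v + b u = C y (u v)'], and the cross terms cancel in the derivative of [a v - b u]. *)
Lemma arg_minus_flux y : arg_minus y * (1 - arg_minus y) = - y * (cosh_arsinh y + y) / 2.
Proof. unfold arg_minus. pose proof (cosh_sqr y). nra. Qed.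

Lemma arg_plus_flux y : arg_plus y * (1 - arg_plus y) = y * (cosh_arsinh y - y) / 2.
Proof. unfold arg_plus. pose proof (cosh_sqr y). nra. Qed.

Lemma small_args y : 0 <= y <= 1/4 ->
  Rabs (arg_minus y) < 1 /\ Rabs (arg_plus y) < 1 /\ Rabs (- y ^ 2) < 1.
Proof.
  intro Hy. pose proof (cosh_ge_1 y). pose proof (cosh_sqr y).
  assert (cosh_arsinh y < 3/2) by nra.
  unfold arg_minus, arg_plus. repeat split; apply Rabs_def1; nra.
Qed.

Section Product_formula.
Variable y0 : R.
Hypothesis Hy0 : 0 < y0 <= 1/4.

Let u y := hg m316 (arg_minus y).
Let v y := hg m316 (arg_plus y).
Let a y := arg_minus y * (1 - arg_minus y) * hg' m316 (arg_minus y).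
Let b y := arg_plus y * (1 - arg_plus y) * hg' m316 (arg_plus y).
Let al1 y := - (cosh_arsinh y + y) / (2 * cosh_arsinh y).
Let be1 y := (cosh_arsinh y - y) / (2 * cosh_arsinh y).
Let G y := PSeries coef (- y ^ 2).
Let D1 y := PSeries (PS_derive coef) (- y ^ 2).
Let D2 y := PSeries (PS_derive (PS_derive coef)) (- y ^ 2).
Let H y := PSeries coef_H (- y ^ 2).
Let E y := PSeries coef_E (- y ^ 2).

Let du y : 0 <= y <= y0 -> is_derive u y (al1 y * hg' m316 (arg_minus y)).
Proof.
  intro Hy. destruct (small_args y ltac:(lra)) as [? [? ?]].
  apply is_derive_hg_comp; [apply m316_bounds|assumption|apply der_arg_minus].
Qed.
Let dv y : 0 <= y <= y0 -> is_derive v y (be1 y * hg' m316 (arg_plus y)).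
Proof.
  intro Hy. destruct (small_args y ltac:(lra)) as [? [? ?]].
  apply is_derive_hg_comp; [apply m316_bounds|assumption|apply der_arg_plus].
Qed.
Let da y : 0 <= y <= y0 -> is_derive a y (al1 y * (m316 * u y)).
Proof.
  intro Hy. destruct (small_args y ltac:(lra)) as [? [? ?]].
  apply is_derive_flux_comp; [apply m316_bounds|assumption|apply der_arg_minus].
Qed.
Let db y : 0 <= y <= y0 -> is_derive b y (be1 y * (m316 * v y)).
Proof.
  intro Hy. destruct (small_args y ltac:(lra)) as [? [? ?]].
  apply is_derive_flux_comp; [apply m316_bounds|assumption|apply der_arg_plus].
Qed.
Let dG y : 0 <= y <= y0 -> is_derive G y (- 2 * y * D1 y).
Proof.
  intro Hy. destruct (small_args y ltac:(lra)) as [? [? ?]].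
  apply (is_derive_PSeries_comp coef (fun t => - t ^ 2)); [now apply coef_inside|apply der_neg_sqr].
Qed.
Let dD1 y : 0 <= y <= y0 -> is_derive D1 y (- 2 * y * D2 y).
Proof.
  intro Hy. destruct (small_args y ltac:(lra)) as [? [? ?]].
  apply (is_derive_PSeries_comp (PS_derive coef) (fun t => - t ^ 2)); [now apply inside_derive, coef_inside|apply der_neg_sqr].
Qed.
Let dH y : 0 <= y <= y0 ->
  is_derive H y (- 2 * y * PSeries (PS_derive coef_H) (- y ^ 2)).
Proof.
  intro Hy. destruct (small_args y ltac:(lra)) as [? [? ?]].
  apply (is_derive_PSeries_comp coef_H (fun t => - t ^ 2)); [now apply coef_H_inside|apply der_neg_sqr].
Qed.
Let dE y : 0 <= y <= y0 ->
  is_derive E y (- 2 * y * PSeries (PS_derive coef_E) (- y ^ 2)).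
Proof.
  intro Hy. destruct (small_args y ltac:(lra)) as [? [? ?]].
  apply (is_derive_PSeries_comp coef_E (fun t => - t ^ 2)); [now apply coef_E_inside|apply der_neg_sqr].
Qed.

Let did (y : R) : is_derive (fun t : R => t) y 1.
Proof. exact (is_derive_id y). Qed.
Let dsq (y : R) : is_derive (fun t : R => t ^ 2) y (2 * y).
Proof. auto_derive; [exact I|cbn; ring]. Qed.
Let dcst (c y : R) : is_derive (fun t : R => c) y 0.
Proof. exact (is_derive_const c y). Qed.

(** The system is linear and homogeneous, so it is applied to the differences between the series
    side and the product side. In [e] the division by [y^2] is already carried out: [C^2 - y^2 = 1]
    gives [a b = - y^2 fa fb / 4], with [fa], [fb] the two values of [hg'], and this makes sense at
    [y = 0]. *)
Let x1 y := G y - u y * v y.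
Let z y := - 2 * y * D1 y - (al1 y * hg' m316 (arg_minus y) * v y + u y * (be1 y * hg' m316 (arg_plus y))).
Let x2 y := cosh_arsinh y * (- 2 * (y ^ 2 * D1 y)) - (a y * v y + b y * u y).
Let e y := - E y + hg' m316 (arg_minus y) * hg' m316 (arg_plus y) / 4.
Let x4 y := - m316 * (y * H y) - (a y * v y - b y * u y).

(** [z] is written with [hg'] itself and not with quotients by [y], so it is differentiable up to
    the singular point 0 and bounded on the closed interval. *)
Let Hz_bounded : exists M, forall y, 0 < y <= y0 -> Rabs (z y) <= M.
Proof.
  destruct (bounded_continuity (V := R_NormedModule) z 0 y0) as [M HM].
  - intros y Hy. destruct (small_args y ltac:(lra)) as [? [? ?]].
    pose proof (cosh_ge_1 y).
    apply (ex_derive_continuous (V := R_NormedModule)).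
    assert (Dal1 : exists l, is_derive al1 y l).
    { unfold al1. eexists.
      apply is_derive_div; [|apply der_mult; [apply dcst|apply der_cosh]|lra].
      eapply is_derive_ext; [|apply der_mult;
        [apply (dcst (-1))|apply der_plus; [apply der_cosh|apply did]]].
      intro t. cbn. ring. }
    assert (Dbe1 : exists l, is_derive be1 y l).
    { unfold be1. eexists.
      apply is_derive_div; [|apply der_mult; [apply dcst|apply der_cosh]|lra].
      apply der_minus; [apply der_cosh|apply did]. }
    assert (Dg : forall g g1, Rabs (g y) < 1 -> is_derive g y g1 ->
      exists l, is_derive (fun t => hg' m316 (g t)) y l).
    { intros g g1 Hg Hg1. eexists.
      apply is_derive_PSeries_comp; [|exact Hg1].
      apply inside_derive, hgc_inside; [apply m316_bounds|assumption]. }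
    destruct Dal1 as [l1 Hl1]. destruct Dbe1 as [l2 Hl2].
    destruct (Dg arg_minus _ ltac:(assumption) (der_arg_minus y)) as [l3 Hl3].
    destruct (Dg arg_plus _ ltac:(assumption) (der_arg_plus y)) as [l4 Hl4].
    eexists. unfold z.
    apply der_minus; [apply der_mult; [apply der_mult; [apply dcst|apply did]|now apply dD1]|].
    apply der_plus; apply der_mult.
    + apply der_mult; [exact Hl1|exact Hl3].
    + exact (dv y Hy).
    + exact (du y Hy).
    + apply der_mult; [exact Hl2|exact Hl4].
  - exists M. intros y Hy. apply Rlt_le, (HM y). lra.
Qed.

Theorem product_formula :
  let C := cosh_arsinh y0 in
  G y0 = u y0 * v y0
  /\ 2 * C * (- y0 ^ 2 * D1 y0) = a y0 * v y0 + b y0 * u y0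
  /\ - m316 * y0 * H y0 = a y0 * v y0 - b y0 * u y0.
Proof.
  destruct Hz_bounded as [M HM].
  assert (Hz : forall y, x2 y = cosh_arsinh y * y * z y).
  { intro y. unfold x2, z, a, b, al1, be1. rewrite arg_minus_flux, arg_plus_flux.
    pose proof (cosh_ge_1 y). field. lra. }
  destruct (system_unique m316 y0 M x1 z x2 e x4 m316_bounds ltac:(lra)) as [R1 [R2 R3]].
  - intros y Hy. unfold x1, z.
    apply der_minus; [now apply dG|]. apply der_mult; [now apply du|now apply dv].
  - intros y Hy. destruct (small_args y ltac:(lra)) as [? [? Hy2]].
    pose proof (cosh_ge_1 y). pose proof (cosh_sqr y) as Hc.
    unfold x2. eapply is_derive_eq.
    + apply der_minus; [apply der_mult; [apply der_cosh|
        apply der_mult; [apply dcst|apply der_mult; [apply dsq|now apply dD1]]]|].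
      apply der_plus; apply der_mult;
        [exact (da y Hy)|exact (dv y Hy)|exact (db y Hy)|exact (du y Hy)].
    + pose proof (ode_G (- y ^ 2) Hy2) as Ho.
      fold (D1 y) (D2 y) (G y) (E y) in Ho.
      unfold e, x1, a, b. rewrite arg_minus_flux, arg_plus_flux. unfold al1, be1.
      generalize (hg' m316 (arg_minus y)) (hg' m316 (arg_plus y)). intros fa fb.
      apply Rminus_diag_uniq.
      (* The goal is a multiple of [ode_G] at [- y^2] plus a multiple of [C^2 - (1 + y^2)]. *)
      match goal with |- ?l = 0 => replace l with
        (- (y / cosh_arsinh y)
           * ((4 * (1 - - y ^ 2) * (D1 y + - y ^ 2 * D2 y) - 2 * (- y ^ 2 * D1 y))
              - (2 * E y + m316 * G y))
         + (4 * y * (y ^ 2 * D2 y - D1 y) / cosh_arsinh y + fa * fb * y / (2 * cosh_arsinh y))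
           * (cosh_arsinh y * cosh_arsinh y - (1 + y * y))) by (field; lra) end.
      rewrite Ho, Hc. ring.
  - intros y Hy. destruct (small_args y ltac:(lra)) as [? [? Hy2]].
    pose proof (cosh_ge_1 y).
    (* Going back from [fa fb / 4] to the product [a b] allows the flux derivatives [da] and [db] to
       be used. *)
    apply (is_derive_ext (fun y => -1 * (y ^ 2 * E y) - a y * b y)).
    + intro t. match goal with |- ?l = ?r => change (@eq R l r) end.
      unfold a, b, e. rewrite arg_minus_flux, arg_plus_flux.
      pose proof (cosh_sqr t) as Hc.
      transitivity (- (t ^ 2 * E t)
        + t ^ 2 * (cosh_arsinh t * cosh_arsinh t - t * t) * (hg' m316 (arg_minus t) * hg' m316 (arg_plus t)) / 4).
      * field.
      * rewrite Hc. field.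
    + eapply is_derive_eq.
      * apply der_minus; [apply der_mult; [apply dcst|
          apply der_mult; [apply dsq|exact (dE y Hy)]]|].
        apply der_mult; [exact (da y Hy)|exact (db y Hy)].
      * pose proof (ode_E (- y ^ 2) Hy2) as Ho.
        fold (D1 y) (E y) (H y) in Ho.
        unfold x4, z, a, b. rewrite arg_minus_flux, arg_plus_flux. unfold al1, be1.
        generalize (hg' m316 (arg_minus y)) (hg' m316 (arg_plus y)). intros fa fb.
        set (E1 := PSeries (PS_derive coef_E) (- y ^ 2)) in *.
        apply Rminus_diag_uniq.
        match goal with |- ?l = 0 => replace l with
          (- (y / 2) * (4 * (E y + - y ^ 2 * E1) - m316 * (m316 * H y + 2 * (- y ^ 2 * D1 y))))
          by (field; lra) end.
        rewrite Ho. ring.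
  - intros y Hy. destruct (small_args y ltac:(lra)) as [? [? Hy2]].
    pose proof (cosh_ge_1 y).
    unfold x4. eapply is_derive_eq.
    + apply der_minus; [apply der_mult; [apply dcst|
        apply der_mult; [apply did|exact (dH y Hy)]]|].
      apply der_minus; apply der_mult;
        [exact (da y Hy)|exact (dv y Hy)|exact (db y Hy)|exact (du y Hy)].
    + pose proof (ode_H (- y ^ 2) Hy2) as Ho.
      fold (H y) (G y) in Ho. unfold x1. rewrite <- Ho.
      unfold a, b. rewrite arg_minus_flux, arg_plus_flux. unfold al1, be1.
      field. lra.
  - intros y Hy. apply Hz.
  - unfold x1, u, v, G, arg_minus, arg_plus, cosh_arsinh. replace (1 + 0 ^ 2) with 1 by ring.
    rewrite sqrt_1. replace ((1 - 1 - 0) / 2) with 0 by field.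
    replace ((1 - 1 + 0) / 2) with 0 by field. replace (- 0 ^ 2) with 0 by ring.
    rewrite !hg_0, PSeries_0, coef_0. ring.
  - unfold x4, a, b. rewrite arg_minus_flux, arg_plus_flux. field.
  - exact HM.
  - assert (R0 := Hz y0). rewrite R1, Rmult_0_r in R0.
    unfold x1 in R2. unfold x2 in R0. unfold x4 in R3. cbv zeta. lra.
Qed.
End Product_formula.

(** * Two algebraic transformations *)

Lemma is_derive_0_eq (f f' : R -> R) (a b : R) :
  a < b -> (forall t, a <= t <= b -> is_derive f t (f' t)) ->
  (forall t, a < t < b -> f' t = 0) -> f a = f b.
Proof.
  intros Hab Hd H0.
  destruct (MVT_cor2 f f' a b Hab) as [c [Hc Hc']].
  - intros t Ht. apply is_derive_Reals. now apply Hd.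
  - rewrite H0, Rmult_0_l in Hc by exact Hc'. lra.
Qed.

(** Two solutions of [(w g')' = k g] that are regular at the singular point
    [1], where [w] vanishes, are proportional: their Wronskian is constant and
    vanishes at [1]. *)
Lemma regular_solution_unique (lo : R) (w k g g1 G M M1 N : R -> R) :
  lo < 1 -> w 1 = 0 -> (forall t, lo <= t < 1 -> w t <> 0) ->
  (forall t, lo <= t <= 1 -> is_derive g t (g1 t)) ->
  (forall t, lo <= t <= 1 -> is_derive M t (M1 t)) ->
  (forall t, lo <= t <= 1 -> G t = w t * g1 t) ->
  (forall t, lo <= t <= 1 -> N t = w t * M1 t) ->
  (forall t, lo <= t <= 1 -> is_derive G t (k t * g t)) ->
  (forall t, lo <= t <= 1 -> is_derive N t (k t * M t)) ->
  (forall t, lo <= t <= 1 -> 0 < M t) ->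
  g 1 = M 1 ->
  g lo = M lo /\ g1 lo = M1 lo.
Proof.
  intros Hlo Hw1 Hw Hg HM HG HN HG' HN' Hpos H1.
  assert (HW : forall t, lo <= t < 1 -> g t * M1 t = M t * g1 t).
  { intros t Ht.
    assert (HWt : g t * N t - M t * G t = g 1 * N 1 - M 1 * G 1).
    { apply (is_derive_0_eq (fun t => g t * N t - M t * G t)
        (fun t => g1 t * N t + g t * (k t * M t) - (M1 t * G t + M t * (k t * g t)))).
      - lra.
      - intros s Hs. apply der_minus; apply der_mult.
        + apply Hg; lra.
        + apply HN'; lra.
        + apply HM; lra.
        + apply HG'; lra.
      - intros s Hs. rewrite HN, HG by lra. ring. }
    rewrite !HN, !HG, Hw1 in HWt by lra.
    apply Rmult_eq_reg_l with (w t); [|now apply Hw].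
    lra. }
  assert (Hq : g lo / M lo = g 1 / M 1).
  { apply (is_derive_0_eq (fun t => g t / M t)
      (fun t => (g1 t * M t - g t * M1 t) / M t ^ 2)); [exact Hlo| |].
    - intros t Ht. specialize (Hpos t Ht). apply is_derive_div; [now apply Hg|now apply HM|lra].
    - intros t Ht. rewrite HW by lra. unfold Rdiv. ring. }
  assert (HM1 := Hpos 1 ltac:(lra)). assert (HMl := Hpos lo ltac:(lra)).
  assert (Hgl : g lo = M lo).
  { rewrite H1, Rdiv_diag in Hq by lra.
    apply Rmult_eq_reg_r with (/ M lo); [|apply Rinv_neq_0_compat; lra].
    unfold Rdiv in Hq. rewrite Hq, Rinv_r; lra. }
  split; [exact Hgl|].
  specialize (HW lo ltac:(lra)). rewrite Hgl in HW.
  symmetry. apply Rmult_eq_reg_l with (M lo); lra.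
Qed.

Lemma quarter_bounds : 0 < 1/4 <= 1/4.
Proof. lra. Qed.

(** The complete elliptic integral in the squared modulus, divided by [PI / 2]. *)
Definition ellK (x : R) : R := hg (1/4) x.
Definition ellK' (x : R) : R := hg' (1/4) x.

Section Quartic.
(** Landen's [K(1 - p^2) = 2 / (1 + p) K(X)] with [X = ((1 - p) / (1 + p))^2], followed by the
    quadratic transformation [K(X) = (1 - 2 X)^(-1/2) f(4 X (X - 1) / (1 - 2 X)^2)]. Here
    [1 - 2 X = Q / (1 + p)^2], and [1 - alp = (1 + p)^4 / Q^2]. *)
Let Q p := 6 * p - 1 - p ^ 2.
Let h p := 2 / sqrt (Q p).
Let alp p := - 16 * p * (1 - p) ^ 2 / Q p ^ 2.
Let alp1 p := 16 * (1 - p) * (1 + p) ^ 3 / Q p ^ 3.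
Let h1 p := - ((6 - 2 * p) / (2 * Q p)) * h p.

(** The interval reaches from just below the special [p], about 0.7016, to the point 1 where [alp]
    vanishes; on it [alp] stays in the disc of convergence. *)
Lemma quartic_Q_pos p : 7/10 <= p <= 1 -> 0 < Q p.
Proof. intro Hp. unfold Q. nra. Qed.

Let Dh p : 7/10 <= p <= 1 -> is_derive h p (h1 p).
Proof.
  intro Hp. pose proof (quartic_Q_pos p Hp) as HQ.
  assert (Hs := sqrt_lt_R0 _ HQ). assert (Hss := sqrt_sqrt _ (Rlt_le _ _ HQ)).
  unfold h1, h. eapply is_derive_eq.
  - apply is_derive_div; [apply (is_derive_const 2 p)| |lra].
    apply (is_derive_comp sqrt Q).
    + apply is_derive_Reals, derivable_pt_lim_sqrt, HQ.
    + unfold Q. auto_derive; [exact I|reflexivity].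
  - unfold scal, zero; cbn -[pow]. unfold mult; cbn -[pow].
    replace (2 * Q p) with (2 * (sqrt (Q p) * sqrt (Q p))) by now rewrite Hss.
    field. lra.
Qed.

Let Dalp p : 7/10 <= p <= 1 -> is_derive alp p (alp1 p).
Proof.
  intro Hp. pose proof (quartic_Q_pos p Hp) as HQ.
  unfold alp, alp1, Q in *. auto_derive.
  - apply Rgt_not_eq. cbn in HQ |- *. nra.
  - field. cbn in HQ |- *. lra.
Qed.

Let alp_small p : 7/10 <= p <= 1 -> Rabs (alp p) < 1.
Proof.
  intro Hp. pose proof (quartic_Q_pos p Hp) as HQ. unfold alp.
  assert (0 < Q p ^ 2) by (apply pow_lt, HQ).
  assert (0 <= p * (1 - p) ^ 2) by (apply Rmult_le_pos; [lra|apply pow2_ge_0]).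
  apply Rabs_def1.
  - apply Rlt_div_l; lra.
  - apply Rlt_div_r; [lra|].
    assert (2 < Q p) by (unfold Q; nra).
    assert ((1 - p) ^ 2 <= 9/100) by nra.
    assert (p * (1 - p) ^ 2 <= 1 * (9/100)) by (apply Rmult_le_compat; nra).
    nra.
Qed.

Let flux p : 7/10 <= p <= 1 -> alp p * (1 - alp p) = - 16 * p * (1 - p) ^ 2 * (1 + p) ^ 4 / Q p ^ 4.
Proof.
  intro Hp. pose proof (quartic_Q_pos p Hp) as HQ. unfold alp, Q in *. field. cbn in HQ |- *. lra.
Qed.

Lemma quartic_transformation p : 7/10 <= p < 1 ->
  hg m316 (alp p) * h p = ellK (1 - p ^ 2)
  /\ alp1 p * hg' m316 (alp p) * h p + hg m316 (alp p) * h1 p = - 2 * p * ellK' (1 - p ^ 2).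
Proof.
  intro Hp.
  assert (Hsm : forall t, 7/10 <= t <= 1 -> Rabs (1 - t ^ 2) < 1).
  { intros t Ht. apply Rabs_def1; nra. }
  assert (Dx : forall t, is_derive (fun t => 1 - t ^ 2) t (- 2 * t)).
  { intro t. auto_derive; [exact I|cbn; ring]. }
  (* The weight and the factor [k] come from pulling the equation of [ellK] back along
     [x = 1 - p^2]. The long function is [w g1] expressed by the flux of [hg m316], so that its
     derivative is known. *)
  apply (regular_solution_unique p (fun p => p * (1 - p) * (1 + p)) (fun p => p)
    (fun p => hg m316 (alp p) * h p)
    (fun p => alp1 p * hg' m316 (alp p) * h p + hg m316 (alp p) * h1 p)
    (fun p => - 1 * (Q p * h p * (alp p * (1 - alp p) * hg' m316 (alp p)))
       + - 1 * (p * (1 - p) * (1 + p) * (3 - p) / Q p * (h p * hg m316 (alp p))))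
    (fun p => ellK (1 - p ^ 2)) (fun p => - 2 * p * ellK' (1 - p ^ 2))
    (fun p => - 2 * ((1 - p ^ 2) * (1 - (1 - p ^ 2)) * ellK' (1 - p ^ 2)))).
  - lra.
  - ring.
  - intros t Ht. apply Rgt_not_eq. repeat apply Rmult_lt_0_compat; lra.
  - intros t Ht. apply (der_mult (fun p => hg m316 (alp p)) h); [|apply Dh; lra].
    apply (is_derive_hg_comp m316 m316_bounds alp); [apply alp_small; lra|apply Dalp; lra].
  - intros t Ht. apply (is_derive_hg_comp (1/4) quarter_bounds (fun p => 1 - p ^ 2)); [apply Hsm; lra|apply Dx].
  - intros t Ht. pose proof (quartic_Q_pos t ltac:(lra)) as HQ.
    rewrite flux by lra. unfold alp1, h1. field. lra.
  - intros t Ht. ring.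
  - intros t Ht. pose proof (quartic_Q_pos t ltac:(lra)) as HQ.
    eapply is_derive_eq.
    + apply der_plus; (apply der_mult; [apply (is_derive_const (-1) t)|]).
      * apply der_mult; [apply der_mult; [|apply Dh; lra]|].
        { unfold Q. auto_derive; [exact I|reflexivity]. }
        apply (is_derive_flux_comp m316 m316_bounds alp); [apply alp_small; lra|apply Dalp; lra].
      * apply der_mult; [|apply der_mult; [apply Dh; lra|
          apply (is_derive_hg_comp m316 m316_bounds alp); [apply alp_small; lra|apply Dalp; lra]]].
        unfold Q in *. auto_derive; [cbn in HQ |- *; lra|reflexivity].
    + cbv beta. rewrite flux by lra. unfold alp1, h1, m316, Q in *. unfold zero; cbn -[pow].
      field. cbn in HQ |- *; lra.
  - intros t Ht. eapply is_derive_eq.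
    + apply der_mult; [apply (is_derive_const (-2) t)|].
      apply (is_derive_flux_comp (1/4) quarter_bounds (fun p => 1 - p ^ 2)); [apply Hsm; lra|apply Dx].
    + unfold ellK, zero; cbn -[pow]. field.
  - intros t Ht. apply hg_pos; [apply quarter_bounds|nra].
  - unfold ellK, alp, h, Q. replace (6 * 1 - 1 - 1 ^ 2) with (2 * 2) by ring.
    rewrite sqrt_square by lra. replace (-16 * 1 * (1 - 1) ^ 2 / (2 * 2) ^ 2) with 0 by field.
    replace (1 - 1 ^ 2) with 0 by ring. rewrite !hg_0. field.
Qed.
End Quartic.

Section Quadratic.
(** The classical [f(z^2) = (1 + z)^(-1/2) K(2 z / (1 + z))] at [z = (1 - v) / (1 + v)]. At
    [v = 1 - p^2] it yields the complementary value [K(p^2)]. *)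
Let h v := sqrt 2 / sqrt (1 + v).
Let bet v := ((1 - v) / (1 + v)) ^ 2.
Let bet1 v := - 4 * (1 - v) / (1 + v) ^ 3.
Let h1 v := - / (2 * (1 + v)) * h v.

Let Dh v : 0 < v <= 1 -> is_derive h v (h1 v).
Proof.
  intro Hv. assert (HQ : 0 < 1 + v) by lra.
  assert (Hs := sqrt_lt_R0 _ HQ). assert (Hss := sqrt_sqrt _ (Rlt_le _ _ HQ)).
  unfold h1, h. eapply is_derive_eq.
  - apply is_derive_div; [apply (is_derive_const (sqrt 2) v)| |lra].
    apply (is_derive_comp sqrt (fun v => 1 + v)).
    + apply is_derive_Reals, derivable_pt_lim_sqrt, HQ.
    + auto_derive; [exact I|reflexivity].
  - unfold scal, zero; cbn -[pow]. unfold mult; cbn -[pow].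
    replace (2 * (1 + v)) with (2 * (sqrt (1 + v) * sqrt (1 + v))) by now rewrite Hss.
    field. lra.
Qed.

Let Dbet v : 0 < v <= 1 -> is_derive bet v (bet1 v).
Proof.
  intro Hv. unfold bet, bet1. auto_derive; [lra|]. field. lra.
Qed.

Let bet_small v : 0 < v <= 1 -> Rabs (bet v) < 1.
Proof.
  intro Hv. unfold bet.
  assert (0 <= (1 - v) / (1 + v)) by (apply Rdiv_le_0_compat; lra).
  assert ((1 - v) / (1 + v) < 1) by (apply Rlt_div_l; lra).
  apply Rabs_def1; nra.
Qed.

Let flux v : 0 < v <= 1 -> bet v * (1 - bet v) = 4 * v * (1 - v) ^ 2 / (1 + v) ^ 4.
Proof. intro Hv. unfold bet. field. lra. Qed.

Lemma quadratic_transformation v : 0 < v < 1 ->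
  hg m316 (bet v) * h v = ellK (1 - v)
  /\ bet1 v * hg' m316 (bet v) * h v + hg m316 (bet v) * h1 v = - 1 * ellK' (1 - v).
Proof.
  intro Hp.
  assert (Hsm : forall t, 0 < t <= 1 -> Rabs (1 - t) < 1).
  { intros t Ht. apply Rabs_def1; lra. }
  assert (Dx : forall t, is_derive (fun t => 1 - t) t (- 1)).
  { intro t. auto_derive; [exact I|cbn; ring]. }
  apply (regular_solution_unique v (fun v => v * (1 - v)) (fun v => 1/4)
    (fun v => hg m316 (bet v) * h v)
    (fun v => bet1 v * hg' m316 (bet v) * h v + hg m316 (bet v) * h1 v)
    (fun v => - 1 * ((1 + v) * h v * (bet v * (1 - bet v) * hg' m316 (bet v)))
       + - 1 * (v * (1 - v) / (2 * (1 + v)) * (h v * hg m316 (bet v))))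
    (fun v => ellK (1 - v)) (fun v => - 1 * ellK' (1 - v))
    (fun v => - 1 * ((1 - v) * (1 - (1 - v)) * ellK' (1 - v)))).
  - lra.
  - ring.
  - intros t Ht. apply Rgt_not_eq. repeat apply Rmult_lt_0_compat; lra.
  - intros t Ht. apply (der_mult (fun v => hg m316 (bet v)) h); [|apply Dh; lra].
    apply (is_derive_hg_comp m316 m316_bounds bet); [apply bet_small; lra|apply Dbet; lra].
  - intros t Ht. apply (is_derive_hg_comp (1/4) quarter_bounds (fun v => 1 - v)); [apply Hsm; lra|apply Dx].
  - intros t Ht. rewrite flux by lra. unfold bet1, h1. field. lra.
  - intros t Ht. ring.
  - intros t Ht. eapply is_derive_eq.
    + apply der_plus; (apply der_mult; [apply (is_derive_const (-1) t)|]).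
      * apply der_mult; [apply der_mult; [|apply Dh; lra]|].
        { auto_derive; [exact I|reflexivity]. }
        apply (is_derive_flux_comp m316 m316_bounds bet); [apply bet_small; lra|apply Dbet; lra].
      * apply der_mult; [|apply der_mult; [apply Dh; lra|
          apply (is_derive_hg_comp m316 m316_bounds bet); [apply bet_small; lra|apply Dbet; lra]]].
        auto_derive; [lra|reflexivity].
    + cbv beta. rewrite flux by lra. unfold bet1, h1, m316. unfold zero; cbn -[pow].
      field. lra.
  - intros t Ht. eapply is_derive_eq.
    + apply der_mult; [apply (is_derive_const (-1) t)|].
      apply (is_derive_flux_comp (1/4) quarter_bounds (fun v => 1 - v)); [apply Hsm; lra|apply Dx].
    + unfold ellK, zero; cbn -[pow]. field.
  - intros t Ht. apply hg_pos; [apply quarter_bounds|lra].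
  - unfold ellK, bet, h. replace (1 + 1) with 2 by ring.
    rewrite Rdiv_diag by (apply Rgt_not_eq, sqrt_lt_R0; lra).
    replace (((1 - 1) / 2) ^ 2) with 0 by field.
    replace (1 - 1) with 0 by ring. rewrite !hg_0. field.
Qed.
End Quadratic.

(** * The Legendre relation *)

Definition sin_int (n : nat) : R := RInt (fun x => sin x ^ n) 0 (PI / 2).

Lemma sin_pow_continuous n x : continuous (fun x => sin x ^ n) x.
Proof.
  apply (ex_derive_continuous (V := R_NormedModule)). auto_derive. exact I.
Qed.

Lemma is_RInt_sin_int n : is_RInt (fun x => sin x ^ n) 0 (PI / 2) (sin_int n).
Proof.
  apply (RInt_correct (V := R_CompleteNormedModule)), (ex_RInt_continuous (V := R_CompleteNormedModule)).
  intros x _. apply sin_pow_continuous.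
Qed.

(** The integrand [(n + 1) sin^n - (n + 2) sin^(n + 2)] is the derivative of [sin^(n + 1) cos],
    which vanishes at both ends. *)
Lemma sin_int_rec n : (INR n + 2) * sin_int (S (S n)) = (INR n + 1) * sin_int n.
Proof.
  assert (H1 : is_RInt (fun x => (INR n + 1) * sin x ^ n - (INR n + 2) * sin x ^ S (S n))
    0 (PI / 2) ((INR n + 1) * sin_int n - (INR n + 2) * sin_int (S (S n)))).
  { apply (is_RInt_minus (V := R_NormedModule));
      apply (is_RInt_scal (V := R_NormedModule)); apply is_RInt_sin_int. }
  assert (H2 : is_RInt (fun x => (INR n + 1) * sin x ^ n - (INR n + 2) * sin x ^ S (S n))
    0 (PI / 2) (sin (PI / 2) ^ S n * cos (PI / 2) - sin 0 ^ S n * cos 0)).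
  { apply (is_RInt_derive (V := R_CompleteNormedModule) (fun x => sin x ^ S n * cos x)).
    - intros x _. auto_derive; [exact I|].
      change (match n with O => 1 | S _ => INR n + 1 end) with (INR (S n)).
      rewrite S_INR. pose proof (sin2_cos2 x) as H. unfold Rsqr in H.
      assert (Hc : cos x * cos x = 1 - sin x * sin x) by lra.
      cbn [pow pred].
      transitivity ((INR n + 1) * sin x ^ n * (cos x * cos x) - sin x * sin x ^ n * sin x);
        [ring|rewrite Hc; ring].
    - intros x _. apply (ex_derive_continuous (V := R_NormedModule)). auto_derive. exact I. }
  rewrite cos_PI2, sin_0, pow_i in H2 by lia.
  apply (is_RInt_unique (V := R_CompleteNormedModule)) in H1, H2. rewrite H1 in H2. lra.
Qed.

Lemma sin_int_decr n : sin_int (S n) <= sin_int n.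
Proof.
  pose proof PI_RGT_0.
  apply RInt_le; [lra| | |].
  - eexists; apply is_RInt_sin_int.
  - eexists; apply is_RInt_sin_int.
  - intros x Hx. assert (0 <= sin x) by (apply sin_ge_0; lra).
    pose proof (SIN_bound x). pose proof (pow_le (sin x) n ltac:(assumption)).
    cbn. nra.
Qed.

Lemma sin_int_0 : sin_int 0 = PI / 2.
Proof.
  change (RInt (fun _ : R => 1) 0 (PI / 2) = PI / 2). rewrite RInt_const.
  unfold scal; cbn. unfold mult; cbn. field.
Qed.

Lemma sin_int_1 : sin_int 1 = 1.
Proof.
  apply (is_RInt_unique (V := R_CompleteNormedModule)).
  replace 1 with (- cos (PI / 2) - - cos 0) by (rewrite cos_PI2, cos_0; ring).
  apply (is_RInt_derive (V := R_CompleteNormedModule) (fun x => - cos x)).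
  - intros x _. auto_derive; [exact I|ring].
  - intros x _. apply sin_pow_continuous.
Qed.

Fixpoint wallis (n : nat) : R :=
  match n with
  | O => 1
  | S k => wallis k * ((2 * INR k + 1) / (2 * INR k + 2))
  end.

Lemma wallis_pos n : 0 < wallis n.
Proof.
  induction n as [|n IH]; cbn [wallis]; [lra|].
  pose proof (pos_INR n). apply Rmult_lt_0_compat; [lra|apply Rdiv_lt_0_compat; lra].
Qed.

Lemma hgc_wallis n : hgc (1/4) n = wallis n ^ 2.
Proof.
  induction n as [|n IH]; cbn [hgc wallis]; [ring|].
  pose proof (pos_INR n). rewrite IH. field. lra.
Qed.

Lemma sin_int_even n : sin_int (2 * n) = PI / 2 * wallis n.
Proof.
  induction n as [|n IH]; [change (2 * 0)%nat with O; rewrite sin_int_0; cbn [wallis]; ring|].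
  pose proof (pos_INR n).
  replace (2 * S n)%nat with (S (S (2 * n))) by lia.
  pose proof (sin_int_rec (2 * n)) as Hr. rewrite IH, mult_INR in Hr. cbn [INR] in Hr.
  cbn [wallis]. apply Rmult_eq_reg_l with (2 * INR n + 2); [|lra].
  replace (2 * INR n + 2) with ((1 + 1) * INR n + 2) at 1 by ring.
  rewrite Hr. field. lra.
Qed.

Lemma sin_int_odd n : sin_int (S (2 * n)) * ((2 * INR n + 1) * wallis n) = 1.
Proof.
  induction n as [|n IH]; [change (S (2 * 0)) with 1%nat; rewrite sin_int_1; cbn [wallis INR]; ring|].
  pose proof (pos_INR n).
  replace (2 * S n)%nat with (S (S (2 * n))) by lia.
  pose proof (sin_int_rec (S (2 * n))) as Hr. rewrite S_INR, mult_INR in Hr. cbn [INR] in Hr.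
  etransitivity; [|exact IH]. cbn [wallis]. rewrite S_INR.
  transitivity ((((1 + 1) * INR n + 1 + 2) * sin_int (S (S (S (2 * n)))))
    * (wallis n * ((2 * INR n + 1) / (2 * INR n + 2)))); [field; lra|].
  rewrite Hr. field. lra.
Qed.

(** Wallis's squeeze: the even integral of index [2n + 2] lies between its odd neighbours. This is
    where [PI] enters. *)
Lemma wallis_bounds n :
  / PI * ((2 * INR n + 2) / (2 * INR n + 3)) <= PS_derive (hgc (1/4)) n <= / PI.
Proof.
  pose proof (pos_INR n) as Hn. pose proof PI_RGT_0 as HPI.
  unfold PS_derive. rewrite hgc_wallis, S_INR.
  pose proof (wallis_pos n) as Hw. pose proof (wallis_pos (S n)) as Hw1.
  pose proof (sin_int_odd (S n)) as Ho. rewrite S_INR in Ho.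
  pose proof (sin_int_decr (2 * S n)) as Hd. rewrite sin_int_even in Hd.
  pose proof (sin_int_odd n) as Ho'. pose proof (sin_int_decr (S (2 * n))) as Hd'.
  replace (S (S (2 * n))) with (2 * S n)%nat in Hd' by lia. rewrite sin_int_even in Hd'.
  split.
  - apply Rmult_le_reg_l with PI; [lra|].
    rewrite <- Rmult_assoc, Rinv_r, Rmult_1_l by lra.
    apply Rle_div_l; [lra|].
    assert (1 <= PI / 2 * wallis (S n) * ((2 * (INR n + 1) + 1) * wallis (S n))).
    { rewrite <- Ho at 1. apply Rmult_le_compat_r; [|exact Hd].
      apply Rmult_le_pos; lra. }
    nra.
  - apply Rmult_le_reg_l with PI; [lra|]. rewrite Rinv_r by lra.
    assert (PI / 2 * wallis (S n) * ((2 * INR n + 1) * wallis n) <= 1).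
    { rewrite <- Ho' at 2. apply Rmult_le_compat_r; [|exact Hd'].
      apply Rmult_le_pos; lra. }
    assert (He : (2 * INR n + 1) * wallis n = (2 * INR n + 2) * wallis (S n)).
    { cbn [wallis]. field. lra. }
    rewrite He in *. lra.
Qed.

Lemma is_lim_seq_inv_S : is_lim_seq (fun n => / INR (S n)) 0.
Proof.
  apply -> (is_lim_seq_incr_1 (fun n => / INR n)).
  apply (is_lim_seq_inv INR p_infty); [apply is_lim_seq_INR|discriminate].
Qed.

Lemma hgc_derive_limit : is_lim_seq (PS_derive (hgc (1/4))) (/ PI).
Proof.
  apply (is_lim_seq_le_le (fun n => / PI * (1 - / (2 * INR n + 3))) _ (fun _ => / PI)).
  - intro n. destruct (wallis_bounds n) as [H1 H2]. split; [|exact H2].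
    pose proof (pos_INR n).
    replace (1 - / (2 * INR n + 3)) with ((2 * INR n + 2) / (2 * INR n + 3)) by (field; lra).
    exact H1.
  - replace (Finite (/ PI)) with (Rbar_mult (/ PI) (1 - 0)) by (cbn; f_equal; ring).
    apply is_lim_seq_scal_l, is_lim_seq_minus'; [apply is_lim_seq_const|].
    apply (is_lim_seq_le_le (fun _ => 0) _ (fun n => / (INR n + 1))).
    + intro n. pose proof (pos_INR n). split.
      * apply Rlt_le, Rinv_0_lt_compat. lra.
      * apply Rinv_le_contravar; lra.
    + apply is_lim_seq_const.
    + apply (is_lim_seq_ext (fun n => / INR (S n))).
      * intro n. now rewrite S_INR.
      * apply is_lim_seq_inv_S.
  - apply is_lim_seq_const.
Qed.

Lemma hgc_limit : is_lim_seq (hgc (1/4)) 0.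
Proof.
  apply is_lim_seq_incr_1.
  apply (is_lim_seq_ext (fun n => PS_derive (hgc (1/4)) n * / INR (S n))).
  - intro n. unfold PS_derive. field. apply not_0_INR. lia.
  - replace (Finite 0) with (Rbar_mult (/ PI) 0) by (cbn; f_equal; ring).
    apply is_lim_seq_mult'; [apply hgc_derive_limit|apply is_lim_seq_inv_S].
Qed.

(** Supplies the boundary behaviour at 1: [(1 - x) K(x)] tends to 0 by [hgc_limit], and
    [(1 - x) K'(x)] to [/ PI] by [hgc_derive_limit]. *)
Lemma abel_limit (a : nat -> R) (l : R) (x : nat -> R) :
  (forall t, Rabs t < 1 -> inside a t) -> is_lim_seq a l ->
  (forall n, 0 <= x n < 1) -> is_lim_seq x 1 ->
  is_lim_seq (fun n => (1 - x n) * PSeries a (x n)) l.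
Proof.
  intros Ha Hl Hx Hx1.
  (* [b] has partial sums [a n], and [PSeries b x = (1 - x) * PSeries a x]. *)
  set (b := PS_minus a (PS_incr_1 a)).
  assert (Hsum : forall n, sum_n b n = a n).
  { induction n as [|n IH].
    - rewrite sum_O. unfold b, PS_minus, PS_plus, PS_opp, PS_incr_1, plus, opp, zero; cbn. ring.
    - rewrite sum_Sn, IH. unfold b, PS_minus, PS_plus, PS_opp, PS_incr_1, plus, opp; cbn. ring. }
  assert (Hb : is_series b l).
  { apply (filterlim_ext a); [intro n; now rewrite Hsum|exact Hl]. }
  assert (Hb1 : is_pseries b 1 l).
  { apply is_pseries_R. eapply is_series_ext; [|exact Hb].
    intro n. cbn. now rewrite pow1, Rmult_1_r. }
  assert (Heq : forall n, PSeries b (x n) = (1 - x n) * PSeries a (x n)).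
  { intro n. assert (Hi : inside a (x n)) by (apply Ha; rewrite Rabs_pos_eq; apply Hx).
    unfold b. rewrite PSeries_minus, PSeries_incr_1.
    - ring.
    - apply CV_radius_inside, Hi.
    - apply CV_radius_inside, inside_incr, Hi. }
  apply (is_lim_seq_ext _ _ _ Heq).
  rewrite <- (is_pseries_unique _ _ _ Hb1).
  assert (Hr : Rbar_le 1 (CV_radius b)).
  { apply Rbar_not_lt_le. intro Hlt.
    apply (CV_disk_outside b 1); [now rewrite Rabs_R1|].
    apply (is_lim_seq_ext b); [intro n; now rewrite pow1, Rmult_1_r|].
    apply ex_series_lim_0. now exists l. }
  destruct (Rbar_le_lt_or_eq_dec _ _ Hr) as [Hr1|Hr1].
  - apply (is_lim_seq_continuous (PSeries b) x 1); [|exact Hx1].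
    apply PSeries_continuity. now rewrite Rabs_R1.
  - assert (HA := Abel b). rewrite <- Hr1 in HA. cbn in HA.
    specialize (HA Rlt_0_1 I ltac:(now exists l)).
    refine (filterlim_comp _ _ _ x (PSeries b) eventually (at_left 1) _ _ HA).
    intros P HP.
    destruct (Hx1 (fun y => y < 1 -> P y) HP) as [N HN].
    exists N. intros n Hn. apply HN; [exact Hn|apply Hx].
Qed.

(** The left side is a Wronskian of [K(v)] and [K(1 - v)], hence constant on the open interval. Its
    value is read off along [t n], which tends to 0: the first product vanishes in the limit and the
    second one tends to [/ PI]. *)
Lemma legendre_relation v : 0 < v < 1 ->
  v * (1 - v) * (ellK' v * ellK (1 - v) + ellK v * ellK' (1 - v)) = / PI.
Proof.
  set (W := fun v => (v * (1 - v) * ellK' v) * ellK (1 - v)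
                     + ellK v * ((1 - v) * (1 - (1 - v)) * ellK' (1 - v))).
  assert (HW : forall s t, 0 < s -> s < t -> t < 1 -> W s = W t).
  { intros s t Hs Hst Ht.
    apply (is_derive_0_eq W (fun v => 1 * (1/4 * ellK v) * ellK (1 - v)
      + (v * (1 - v) * ellK' v) * (- 1 * ellK' (1 - v))
      + (1 * ellK' v * ((1 - v) * (1 - (1 - v)) * ellK' (1 - v))
         + ellK v * (- 1 * (1/4 * ellK (1 - v)))))); [exact Hst| |].
    - intros r Hr.
      assert (Rabs r < 1) by (apply Rabs_def1; lra).
      assert (Rabs (1 - r) < 1) by (apply Rabs_def1; lra).
      assert (D1 : is_derive (fun v : R => v) r 1) by exact (is_derive_id r).
      assert (D2 : is_derive (fun v : R => 1 - v) r (-1)) by (auto_derive; [exact I|ring]).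
      apply (der_plus (fun v => v * (1 - v) * ellK' v * ellK (1 - v))
        (fun v => ellK v * ((1 - v) * (1 - (1 - v)) * ellK' (1 - v)))).
      1: apply (der_mult (fun v => v * (1 - v) * ellK' v) (fun v => ellK (1 - v))).
      3: apply (der_mult ellK (fun v => (1 - v) * (1 - (1 - v)) * ellK' (1 - v))).
      + now apply (is_derive_flux_comp (1/4) quarter_bounds (fun v => v)).
      + now apply (is_derive_hg_comp (1/4) quarter_bounds (fun v => 1 - v)).
      + now apply (is_derive_hg_comp (1/4) quarter_bounds (fun v => v)).
      + now apply (is_derive_flux_comp (1/4) quarter_bounds (fun v => 1 - v)).
    - intros r Hr. ring. }
  intro Hv.
  replace (v * (1 - v) * (ellK' v * ellK (1 - v) + ellK v * ellK' (1 - v))) with (W v)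
    by (unfold W; ring).
  set (t := fun n => / (INR n + 2)).
  assert (Ht : forall n, 0 < t n < 1).
  { intro n. pose proof (pos_INR n). unfold t. split; [apply Rinv_0_lt_compat; lra|].
    rewrite <- Rinv_1. apply Rinv_lt_contravar; lra. }
  assert (Hlt : is_lim_seq t 0).
  { apply (is_lim_seq_ext (fun n => / INR (S (S n)))).
    - intro n. unfold t. rewrite !S_INR. f_equal. ring.
    - apply -> (is_lim_seq_incr_1 (fun n => / INR (S n))).
      apply is_lim_seq_inv_S. }
  assert (Hl1 : is_lim_seq (fun n => 1 - t n) 1).
  { replace (Finite 1) with (Finite (1 - 0)) by (f_equal; ring).
    apply is_lim_seq_minus'; [apply is_lim_seq_const|exact Hlt]. }
  assert (Hin : forall s, Rabs s < 1 -> inside (hgc (1/4)) s)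
    by (intro s; apply hgc_inside, quarter_bounds).
  assert (Hk := abel_limit _ _ (fun n => 1 - t n) Hin hgc_limit
    ltac:(intro n; pose proof (Ht n); lra) Hl1).
  assert (Hk' := abel_limit _ _ (fun n => 1 - t n)
    (fun s Hs => inside_derive _ _ (Hin s Hs)) hgc_derive_limit
    ltac:(intro n; pose proof (Ht n); lra) Hl1).
  assert (H0 : Rabs 0 < 1) by (rewrite Rabs_R0; lra).
  assert (Hc : is_lim_seq (fun n => ellK (t n)) (ellK 0)).
  { apply is_lim_seq_continuous; [|exact Hlt]. apply PSeries_continuity, Hin, H0. }
  assert (Hc' : is_lim_seq (fun n => ellK' (t n)) (ellK' 0)).
  { apply is_lim_seq_continuous; [|exact Hlt]. apply PSeries_continuity, inside_derive, Hin, H0. }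
  assert (HWl : is_lim_seq (fun n => W (t n)) (/ PI)).
  { replace (/ PI) with (1 * ellK' 0 * 0 + ellK 0 * 1 * / PI)
      by (unfold ellK; rewrite hg_0; ring).
    eapply is_lim_seq_ext; [|apply is_lim_seq_plus';
      [apply is_lim_seq_mult'; [apply is_lim_seq_mult'; [exact Hl1|exact Hc']|exact Hk]
      |apply is_lim_seq_mult'; [apply is_lim_seq_mult'; [exact Hc|exact Hl1]|exact Hk']]].
    intro n. unfold W, ellK, ellK', hg, hg'. cbn -[PSeries PS_derive hgc]. ring. }
  assert (HWc : is_lim_seq (fun n => W (t n)) (W v)).
  { apply (is_lim_seq_ext (fun _ => W v)); [|apply is_lim_seq_const].
    intro n. pose proof (Ht n).
    destruct (Rtotal_order v (t n)) as [Hlt'|[->|Hgt]]; [|reflexivity|].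
    - apply HW; lra.
    - symmetry. apply HW; lra. }
  apply is_lim_seq_unique in HWl. apply is_lim_seq_unique in HWc.
  rewrite HWl in HWc. now injection HWc.
Qed.

(** * The special point *)

Section Quadratic_field.
Variable p : R.
Hypothesis Hp : p ^ 2 = 4 - 5 * p.
Hypothesis Hp1 : 7/10 <= p < 1.

(** With these values at hand [lra] decides identities in Q(sqrt 41), treating each power of [p] as
    an atom. *)
Lemma p_powers : p ^ 3 = 29 * p - 20 /\ p ^ 4 = 116 - 165 * p.
Proof.
  assert (H3 : p ^ 3 = 29 * p - 20)
    by (replace (p ^ 3) with (p * p ^ 2) by ring; rewrite Hp; lra).
  assert (H4 : p ^ 4 = 116 - 165 * p)
    by (replace (p ^ 4) with (p * p ^ 3) by ring; rewrite H3; lra).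
  now split.
Qed.

(** The rational constants are coordinates in the basis [1], [p] of Q(sqrt 41)
    of the coefficients of the two transformations and of the product formula
    at the special point. *)
Lemma special_combination (K K1 L L1 U V Fa Fb h g S q : R) :
  U * h = K -> V * g = L ->
  (12752 + 2160 * p) / 12167 * Fa * h - (17/23 + 7/46 * p) * (U * h) = - 2 * p * K1 ->
  - (6216 + 1100 * p) / 12167 * Fb * g - (27/92 + 5/92 * p) * (V * g) = - L1 ->
  h * g * (q * (1 - p)) = 2 ->
  (160 * p - 112) * (K1 * L + K * L1) = / PI ->
  S = (2645/2 + 529 * p - 529/6) * ((- 35392 - 10880 * p) / 279841 * Fa * V)
      + (2645/2 + 529 * p + 529/6) * ((19008 + 10880 * p) / 279841 * Fb * U)
      + 276 * (U * V) ->
  S = 529 * (q / (3 * PI)).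
Proof.
  intros HU HV HA HB Hhg HL HS.
  destruct p_powers as [H3 H4].
  assert (EA : Fa * h = (1/4 + 43/64 * p) * K + (135/4 - 797/16 * p) * K1).
  { rewrite HU in HA.
    apply Rmult_eq_reg_l with ((12752 + 2160 * p) / 12167); [|lra].
    transitivity (- 2 * p * K1 + (17/23 + 7/46 * p) * K); [lra|].
    assert (C1 : (12752 + 2160 * p) / 12167 * (1/4 + 43/64 * p) = 17/23 + 7/46 * p) by lra.
    assert (C2 : (12752 + 2160 * p) / 12167 * (135/4 - 797/16 * p) = - 2 * p) by lra.
    rewrite Rmult_plus_distr_l, <- !Rmult_assoc, C1, C2. ring. }
  assert (EB : Fb * g = (- 29/32 + 15/32 * p) * L + (- 179/8 + 275/8 * p) * L1).
  { rewrite HV in HB.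
    apply Rmult_eq_reg_l with (- (6216 + 1100 * p) / 12167); [|lra].
    transitivity (- L1 + (27/92 + 5/92 * p) * L); [lra|].
    assert (C1 : - (6216 + 1100 * p) / 12167 * (- 29/32 + 15/32 * p) = 27/92 + 5/92 * p) by lra.
    assert (C2 : - (6216 + 1100 * p) / 12167 * (- 179/8 + 275/8 * p) = - 1) by lra.
    rewrite Rmult_plus_distr_l, <- !Rmult_assoc, C1, C2. ring. }
  (* After multiplication by [h * g], [S] is a combination of [K L], [K1 L] and [K L1]. The weight
     276 of [U V] makes [K L] disappear, and the two mixed terms receive the same coefficient, as
     the Legendre relation requires. *)
  assert (E : S * (h * g) = 1058/3 * (24 * p - 16) * (K1 * L + K * L1)).
  { rewrite HS.
    transitivity ((2645/2 + 529 * p - 529/6) * ((- 35392 - 10880 * p) / 279841) * (Fa * h) * (V * g)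
      + (2645/2 + 529 * p + 529/6) * ((19008 + 10880 * p) / 279841) * (Fb * g) * (U * h)
      + 276 * ((U * h) * (V * g))); [ring|].
    rewrite EA, EB, HU, HV.
    assert (C1 : (2645/2 + 529 * p - 529/6) * ((- 35392 - 10880 * p) / 279841)
        * (1/4 + 43/64 * p)
      + (2645/2 + 529 * p + 529/6) * ((19008 + 10880 * p) / 279841)
        * (- 29/32 + 15/32 * p) + 276 = 0) by lra.
    assert (C2 : (2645/2 + 529 * p - 529/6) * ((- 35392 - 10880 * p) / 279841)
      * (135/4 - 797/16 * p) = 1058/3 * (24 * p - 16)) by lra.
    assert (C3 : (2645/2 + 529 * p + 529/6) * ((19008 + 10880 * p) / 279841)
      * (- 179/8 + 275/8 * p) = 1058/3 * (24 * p - 16)) by lra.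
    match type of C1 with ?c = _ => match type of C2 with ?c2 = _ => match type of C3 with ?c3 = _ =>
      transitivity (c * (K * L) + c2 * (K1 * L) + c3 * (K * L1)); [ring|] end end end.
    rewrite C1, C2, C3. ring. }
  assert (C : (24 * p - 16) * (1 - p) = 160 * p - 112) by lra.
  transitivity (S * (h * g) * (q * (1 - p)) / 2).
  { transitivity (S * (h * g * (q * (1 - p))) / 2); [rewrite Hhg; field|field]. }
  rewrite E.
  transitivity (529/3 * q * (((24 * p - 16) * (1 - p)) * (K1 * L + K * L1))); [field|].
  rewrite C, HL. pose proof PI_RGT_0. field. lra.
Qed.
End Quadratic_field.

Lemma Q_sqrt41 : exists p, p ^ 2 = 4 - 5 * p /\ 7/10 <= p < 1.
Proof.
  exists ((sqrt 41 - 5) / 2).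
  assert (H := sqrt_sqrt 41 ltac:(lra)).
  assert (H64 : 64/10 <= sqrt 41).
  { rewrite <- (sqrt_square (64/10)) by lra. apply sqrt_le_1; lra. }
  assert (sqrt 41 < 7).
  { rewrite <- (sqrt_square 7) by lra. apply sqrt_lt_1; lra. }
  split; [nra|lra].
Qed.

Definition y529 : R := 128/529.

(** The weights are the partial fractions [(6970 n^2 + 4037 n + 280) / (2n + 1) = 3485 n + 276 + 4 /
    (2n + 1)]. *)
Lemma special_sum :
  3485 * (- y529 ^ 2 * PSeries (PS_derive coef) (- y529 ^ 2)) + 276 * PSeries coef (- y529 ^ 2)
  + 4 * PSeries coef_H (- y529 ^ 2) = 529 * (sqrt 23 / (3 * PI)).
Proof.
  destruct Q_sqrt41 as [p [Hp Hp1]].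
  destruct (p_powers p Hp) as [H3 H4].
  destruct (quartic_transformation p Hp1) as [TA TA'].
  assert (Hv : 0 < 1 - p ^ 2 < 1) by nra.
  destruct (quadratic_transformation (1 - p ^ 2) Hv) as [TB TB'].
  assert (LR := legendre_relation (1 - p ^ 2) Hv).
  destruct (product_formula y529 ltac:(unfold y529; lra)) as [P1 [P2 P3]].
  (* [529^2 + 128^2 = 85^2 * 41], and [2 p + 5] is the square root of 41. *)
  assert (HC : cosh_arsinh y529 = 85 * (2 * p + 5) / 529).
  { apply Rsqr_inj; [pose proof (cosh_ge_1 y529); lra|lra|].
    unfold Rsqr. rewrite cosh_sqr. unfold y529. nra. }
  set (Q := 6 * p - 1 - p ^ 2) in *.
  assert (HQ : Q = 11 * p - 5) by (unfold Q; lra).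
  assert (Hal : arg_minus y529 = - 16 * p * (1 - p) ^ 2 / Q ^ 2).
  { unfold arg_minus. rewrite HC, HQ. unfold y529.
    apply Rmult_eq_reg_r with ((11 * p - 5) ^ 2); [|apply pow_nonzero; lra].
    unfold Rdiv at 4. rewrite Rmult_assoc, Rinv_l, Rmult_1_r by (apply pow_nonzero; lra).
    lra. }
  set (v := 1 - p ^ 2) in *.
  assert (Hv5 : v = 5 * p - 3) by (unfold v; lra).
  assert (Hbe : arg_plus y529 = ((1 - v) / (1 + v)) ^ 2).
  { unfold arg_plus. rewrite HC, Hv5. unfold y529.
    apply Rmult_eq_reg_r with ((1 + (5 * p - 3)) ^ 2); [|apply pow_nonzero; lra].
    replace (((1 - (5 * p - 3)) / (1 + (5 * p - 3))) ^ 2 * (1 + (5 * p - 3)) ^ 2)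
      with ((1 - (5 * p - 3)) ^ 2) by (field; lra).
    lra. }
  rewrite <- Hal in TA, TA'. rewrite <- Hbe in TB, TB'.
  rewrite arg_minus_flux, arg_plus_flux in P2, P3. rewrite HC in P2, P3.
  set (U := hg m316 (arg_minus y529)) in *. set (V := hg m316 (arg_plus y529)) in *.
  set (Fa := hg' m316 (arg_minus y529)) in *. set (Fb := hg' m316 (arg_plus y529)) in *.
  set (h := 2 / sqrt Q) in *. set (g := sqrt 2 / sqrt (1 + v)) in *.
  apply (special_combination p Hp Hp1 (ellK v) (ellK' v) (ellK (1 - v)) (ellK' (1 - v))
    U V Fa Fb h g).
  - exact TA.
  - exact TB.
  - rewrite <- TA', HQ.
    assert (C1 : 16 * (1 - p) * (1 + p) ^ 3 / (11 * p - 5) ^ 3 = (12752 + 2160 * p) / 12167).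
    { apply Rmult_eq_reg_r with ((11 * p - 5) ^ 3); [|apply pow_nonzero; lra].
      unfold Rdiv at 1. rewrite Rmult_assoc, Rinv_l, Rmult_1_r by (apply pow_nonzero; lra).
      lra. }
    assert (C2 : (6 - 2 * p) / (2 * (11 * p - 5)) = 17/23 + 7/46 * p).
    { apply Rmult_eq_reg_r with (2 * (11 * p - 5)); [|lra].
      unfold Rdiv at 1. rewrite Rmult_assoc, Rinv_l, Rmult_1_r by lra. lra. }
    rewrite C1, C2. ring.
  - rewrite <- (Rmult_1_l (ellK' (1 - v))), Ropp_mult_distr_l.
    change (- (1)) with (-1). rewrite <- TB', Hv5.
    assert (C1 : -4 * (1 - (5 * p - 3)) / (1 + (5 * p - 3)) ^ 3 = - (6216 + 1100 * p) / 12167).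
    { apply Rmult_eq_reg_r with ((1 + (5 * p - 3)) ^ 3); [|apply pow_nonzero; lra].
      unfold Rdiv at 1. rewrite Rmult_assoc, Rinv_l, Rmult_1_r by (apply pow_nonzero; lra).
      lra. }
    assert (C2 : / (2 * (1 + (5 * p - 3))) = 27/92 + 5/92 * p).
    { apply Rmult_eq_reg_r with (2 * (1 + (5 * p - 3))); [|lra].
      rewrite Rinv_l by lra. lra. }
    rewrite C1, C2. ring.
  - assert (HQ0 : 0 < Q) by lra. assert (Hv0 : 0 < 1 + v) by lra.
    assert (Hs1 := sqrt_lt_R0 _ HQ0). assert (Hs2 := sqrt_lt_R0 _ Hv0).
    (* The origin of [sqrt 23]: [Q (1 + v) = 46 (1 - p)^2]. *)
    assert (Hs : sqrt Q * sqrt (1 + v) = sqrt 2 * sqrt 23 * (1 - p)).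
    { rewrite <- sqrt_mult by lra.
      replace (Q * (1 + v)) with (2 * 23 * ((1 - p) * (1 - p))) by (rewrite HQ, Hv5; lra).
      rewrite (sqrt_mult (2 * 23)), (sqrt_mult 2 23), sqrt_square by nra. reflexivity. }
    unfold h, g.
    transitivity (2 * (sqrt 2 * sqrt 23 * (1 - p)) / (sqrt Q * sqrt (1 + v))).
    + field. lra.
    + rewrite <- Hs. field. lra.
  - rewrite <- LR. replace (160 * p - 112) with (v * (1 - v)) by (rewrite Hv5; lra).
    reflexivity.
  - set (N := - y529 ^ 2 * PSeries (PS_derive coef) (- y529 ^ 2)) in *.
    set (H := PSeries coef_H (- y529 ^ 2)) in *.
    rewrite P1.
    assert (Ea : - y529 * (85 * (2 * p + 5) / 529 + y529) / 2 = (- 35392 - 10880 * p) / 279841)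
      by (unfold y529; lra).
    assert (Eb : y529 * (85 * (2 * p + 5) / 529 - y529) / 2 = (19008 + 10880 * p) / 279841)
      by (unfold y529; lra).
    rewrite Ea, Eb in P2, P3.
    set (X := (- 35392 - 10880 * p) / 279841 * Fa * V) in *.
    set (Y := (19008 + 10880 * p) / 279841 * Fb * U) in *.
    (* The factor in front of [(X + Y) / 2] is the inverse of [C] in Q(sqrt 41). *)
    assert (EN : N = (529/697 + 1058/3485 * p) * ((X + Y) / 2)).
    { apply Rmult_eq_reg_l with (2 * (85 * (2 * p + 5) / 529)); [|lra].
      rewrite P2.
      replace (2 * (85 * (2 * p + 5) / 529) * ((529 / 697 + 1058 / 3485 * p) * ((X + Y) / 2)))
        with ((85 * (2 * p + 5) / 529 * (529 / 697 + 1058 / 3485 * p)) * (X + Y)) by field.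
      replace (85 * (2 * p + 5) / 529 * (529 / 697 + 1058 / 3485 * p)) with 1 by lra.
      ring. }
    assert (EH : H = - (529/24) * (X - Y)).
    { unfold m316, y529 in P3. lra. }
    rewrite EN, EH. unfold U, V. field.
Qed.

Lemma first_series :
  is_series (fun n => coef n * ((- (2 ^ 14)) / 23 ^ 4) ^ n
     * ((6970 * INR n ^ 2 + 4037 * INR n + 280) / (529 * (2 * INR n + 1))))
    (sqrt 23 / (3 * PI)).
Proof.
  assert (Hz : (- (2 ^ 14)) / 23 ^ 4 = - y529 ^ 2) by (unfold y529; field).
  rewrite Hz.
  assert (Hx : Rabs (- y529 ^ 2) < 1) by (apply Rabs_def1; unfold y529; lra).
  assert (S0 := is_series_PSeries _ _ (coef_inside _ Hx)).
  assert (S1 := sums_shift _ _ _ (is_series_PSeries _ _ (inside_derive _ _ (coef_inside _ Hx)))).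
  assert (SH := is_series_PSeries _ _ (coef_H_inside _ Hx)).
  assert (S := sums_scal (/ 529) _ _ _ (sums_plus _ _ _ _ _
    (sums_plus _ _ _ _ _ (sums_scal 3485 _ _ _ S1) (sums_scal 276 _ _ _ S0))
    (sums_scal 4 _ _ _ SH))).
  rewrite special_sum in S.
  replace (/ 529 * (529 * (sqrt 23 / (3 * PI)))) with (sqrt 23 / (3 * PI)) in S
    by (pose proof PI_RGT_0; field; lra).
  eapply is_series_ext; [|exact S].
  intros [|n]; unfold PS_incr_1, PS_derive, coef_H, zero; cbn -[coef INR pow y529].
  - cbn [INR]. field.
  - pose proof (pos_INR n). rewrite !S_INR. field. lra.
Qed.

(** * The telescoping part of the second series *)

Lemma INR_le_pow2 n : INR n <= 2 ^ n.
Proof.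
  induction n as [|n IH]; [cbn; lra|]. rewrite S_INR. cbn [pow].
  pose proof (pow_R1_Rle 2 n ltac:(lra)). lra.
Qed.

(** Since [n^3 <= 8^n], the bound 1/16 on [z] leaves a geometric majorant of ratio 1/2;
    [2^14 / 23^4] is just below 1/16. *)
Lemma cubic_term_limit z : Rabs z <= 1/16 -> is_lim_seq (fun n => INR n ^ 3 * coef n * z ^ n) 0.
Proof.
  intro Hz. apply is_lim_seq_abs_0.
  apply (is_lim_seq_le_le (fun _ => 0) _ (fun n => (1/2) ^ n)).
  - intro n. split; [apply Rabs_pos|].
    pose proof (pos_INR n) as Hn. destruct (coef_bounds n).
    rewrite !Rabs_mult, <- !RPow_abs, (Rabs_pos_eq (INR n)), (Rabs_pos_eq (coef n)) by lra.
    replace ((1/2) ^ n) with ((2 ^ n) ^ 3 * 1 * (1/16) ^ n).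
    + pose proof (Rabs_pos z).
      apply Rmult_le_compat; [|now apply pow_le|apply Rmult_le_compat|now apply pow_incr].
      * apply Rmult_le_pos; [now apply pow_le|lra].
      * now apply pow_le.
      * lra.
      * apply pow_incr. split; [exact Hn|apply INR_le_pow2].
      * lra.
    + rewrite Rmult_1_r, <- pow_mult, Nat.mul_comm, pow_mult, <- Rpow_mult_distr.
      f_equal. field.
  - apply is_lim_seq_const.
  - apply is_lim_seq_geom. rewrite Rabs_pos_eq; lra.
Qed.

Lemma is_series_telescope (T : nat -> R) :
  is_lim_seq T 0 -> is_series (fun n => T (S n) - T n) (- T 0%nat).
Proof.
  intro HT. change (is_lim_seq (sum_n (fun n => T (S n) - T n)) (- T 0%nat)).
  apply (is_lim_seq_ext (fun n => T (S n) - T 0%nat)).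
  - induction n as [|n IH]; [now rewrite sum_O|].
    rewrite sum_Sn, <- IH. unfold plus; cbn. ring.
  - replace (Finite (- T 0%nat)) with (Finite (0 - T 0%nat)) by (f_equal; ring).
    apply is_lim_seq_minus'; [now apply is_lim_seq_incr_1 in HT|apply is_lim_seq_const].
Qed.

Theorem theorem3 :
  is_series
    (fun n : nat =>
       (poch (1/8) n * poch (3/8) n * poch (5/8) n * poch (7/8) n)
       / (poch (1/2) n * (poch 1 n) ^ 3)
       * ((- (2 ^ 14)) / 23 ^ 4) ^ n
       * ((6970 * INR n ^ 2 + 4037 * INR n + 280)
          / (529 * (2 * INR n + 1))))
    (sqrt 23 / (3 * PI))
  /\
  is_series
    (fun n : nat =>
       (poch (1/8) n * poch (3/8) n * poch (5/8) n * poch (7/8) n)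
       / (poch (1/2) n * (poch 1 n) ^ 3)
       * ((- (2 ^ 14)) / 23 ^ 4) ^ n
       * ((- (296225 * INR n ^ 3) - 24576 * INR n ^ 2 + 53002 * INR n + 4200)
          / 3174))
    (sqrt 23 / PI).
Proof.
  split; [exact first_series|].
  set (z := (- (2 ^ 14)) / 23 ^ 4).
  assert (Hz : Rabs z <= 1/16) by (unfold z; apply Rabs_le; lra).
  assert (HT := is_series_telescope _ (cubic_term_limit z Hz)).
  cbv beta in HT. replace (- (INR 0 ^ 3 * coef 0 * z ^ 0)) with 0 in HT by (cbn; ring).
  (* In [T n = n^3 coef n z^n] the cube cancels the [(1 + n)^3] of [coef_S], so [T (n + 1)] keeps
     only the denominator [1/2 + n]. The multiplier 529/6 makes this pole cancel that of three times
     the first series. As [T 0 = 0], the telescoping series adds 0. *)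
  replace (sqrt 23 / PI) with (3 * (sqrt 23 / (3 * PI)) + 529/6 * 0)
    by (pose proof PI_RGT_0; field; lra).
  eapply is_series_ext; [|apply (is_series_plus _ _ _ _
    (is_series_scal_l 3 _ _ first_series) (is_series_scal_l (529/6) _ _ HT))].
  intro n. change (poch (1/8) n * poch (3/8) n * poch (5/8) n * poch (7/8) n
       / (poch (1/2) n * (poch 1 n) ^ 3)) with (coef n).
  fold z. unfold plus; cbn -[coef INR pow z]. rewrite coef_S, S_INR.
  change (z ^ S n) with (z * z ^ n). pose proof (pos_INR n).
  generalize (z ^ n). intro w. unfold z. field. lra.
Qed.
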